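(* Let $(\mathfrak{g},[\cdot,\cdot])$ be a four-dimensional real Lie algebra. In each item below, every three-dimensional subspace $\mathfrak{q}\subset\mathfrak{g}$ generating $\mathfrak{g}$ satisfies one of the listed conditions, and each listed condition is satisfied by some such $\mathfrak{q}$ (i.e. the listed cases are the possible ones). All bases $(e_1,e_2,e_3)$ of $\mathfrak{q}$ mentioned are adapted bases, and $C_{ij}^k$ are the structure constants in the basis $(e_1,e_2,e_3,e_4=[e_1,e_3])$ of $\mathfrak{g}$. 1. If $\mathfrak{g}=2\mathfrak{g}_{2,1}$: 1) $\mathfrak{q}$ contains a one-dimensional ideal of $\mathfrak{g}$; 2) $\mathfrak{q}$ has a basis $(e_1,e_2,e_3)$ such that $[e_1,e_2]=0$ and $0\neq[e_2,e_3]\parallel e_3$. 2. If $\mathfrak{g}$ is one of $\mathfrak{g}_{3,2}\oplus\mathfrak{g}_1$, $\mathfrak{g}_{3,4}^{\alpha}\oplus\mathfrak{g}_1$ ($0\le\alpha\ne1$), $\mathfrak{g}_{4,3}$: 1) $\mathfrak{C}(\mathfrak{g})\subset\mathfrak{q}$; 2) $\mathfrak{q}$ contains a one-dimensional noncentral ideal of $\mathfrak{g}$; 3) $\mathfrak{q}$ has a basis $(e_1,e_2,e_3=[e_1,e_2])$ such that $[e_2,e_3]=0$. 3. If $\mathfrak{g}$ is one of $\mathfrak{g}_{3,5}^{\alpha}\oplus\mathfrak{g}_1$ ($\alpha\ge0$), $\mathfrak{g}_{4,1}$: 1) $\mathfrak{C}(\mathfrak{g})\subset\mathfrak{q}$;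 2) $\mathfrak{q}$ has a basis $(e_1,e_2,e_3=[e_1,e_2])$ such that $[e_2,e_3]=0$. 4. If $\mathfrak{g}=\mathfrak{g}_{3,6}\oplus\mathfrak{g}_1$: 1) $\mathfrak{g}_1\subset\mathfrak{q}$; 2) $\mathfrak{q}$ has a basis $(e_1,e_2,e_3=[e_1,e_2])$ such that $0\ne[e_2,e_3]\parallel e_2$; 3) $\mathfrak{q}$ has a basis $(e_1,e_2,e_3=[e_1,e_2])$ such that $0\ne[e_2,e_3]\parallel e_1$. 5. If $\mathfrak{g}=\mathfrak{g}_{3,7}\oplus\mathfrak{g}_1$: 1) $\mathfrak{C}(\mathfrak{g})\subset\mathfrak{q}$; 2) $\mathfrak{q}$ has a basis $(e_1,e_2,e_3=[e_1,e_2])$ such that $0\ne[e_2,e_3]\parallel e_1$. 6. If $\mathfrak{g}$ is one of $\mathfrak{g}_{4,2}^{\alpha}$ ($\alpha\notin\{0,1\}$), $\mathfrak{g}_{4,4}$, $\mathfrak{g}_{4,5}^{\alpha,\beta}$ ($-1<\alpha<\beta<1$, $\alpha\beta\ne0$, or $\alpha=-1$, $0<\beta<1$), $\mathfrak{g}_{4,6}^{\alpha,\beta}$ ($\alpha>0$, $\beta\in\mathbb{R}$): 1) $\mathfrak{q}$ contains a one-dimensional noncentral ideal of $\mathfrak{g}$; 2) $\mathfrak{q}$ has a basis $(e_1,e_2,e_3=[e_1,e_2])$ such that $[e_2,e_3]=0$. 7. If $\mathfrak{g}$ is one of $\mathfrak{g}_{4,7}$, $\mathfrak{g}_{4,8}^{\alpha}$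 ($-1<\alpha<1$, $\alpha\ne0$), $\mathfrak{g}_{4,9}^{\alpha}$ ($\alpha>0$): 1) $\mathfrak{q}$ contains a one-dimensional noncentral ideal of $\mathfrak{g}$; 2) $\mathfrak{q}$ has a basis $(e_1,e_2,e_3=[e_1,e_2])$ such that $C_{23}^1\ne0$, $C_{23}^2=0$. 8. If $\mathfrak{g}=\mathfrak{g}_{4,8}^{-1}$ or $\mathfrak{g}=\mathfrak{g}_{4,9}^{0}$: 1) $\mathfrak{C}(\mathfrak{g})\subset\mathfrak{q}$; 2) $\mathfrak{q}$ has a basis $(e_1,e_2,e_3=[e_1,e_2])$ such that $C_{23}^1\ne0$, $C_{23}^2=0$. 9. If $\mathfrak{g}=\mathfrak{g}_{4,8}^{0}$: 1) $\mathfrak{q}$ contains a one-dimensional noncentral ideal of $\mathfrak{g}$; 2) $\mathfrak{q}$ has a basis $(e_1,e_2,e_3=[e_1,e_2])$ such that $C_{23}^1=C_{23}^2=0$.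
   Context: A subspace $\mathfrak{q}\subset\mathfrak{g}$ generates $\mathfrak{g}$ if the smallest Lie subalgebra containing it is $\mathfrak{g}$. $\mathfrak{C}(\mathfrak{g})$ is the center of $\mathfrak{g}$. An adapted basis of a three-dimensional generating subspace $\mathfrak{q}$ is a basis $(e_1,e_2,e_3)$ of $\mathfrak{q}$ such that $(e_1,e_2,e_3,e_4:=[e_1,e_3])$ is a basis of $\mathfrak{g}$ and, with $[e_i,e_j]=\sum_kC_{ij}^ke_k$, one has $C_{12}^4=C_{23}^4=0$. $x\parallel y$ means collinear. The Lie algebras have a basis $E_1,E_2,E_3,E_4$ with the following nonzero commutators (up to antisymmetry); in $\mathfrak{g}_{3,j}\oplus\mathfrak{g}_1$ the summand $\mathfrak{g}_1=\langle E_4\rangle$ is central: $2\mathfrak{g}_{2,1}$: $[E_1,E_2]=E_1$, $[E_3,E_4]=E_3$. $\mathfrak{g}_{3,2}\oplus\mathfrak{g}_1$: $[E_2,E_3]=E_1-E_2$, $[E_3,E_1]=E_1$. $\mathfrak{g}_{3,4}^{\alpha}\oplus\mathfrak{g}_1$: $[E_2,E_3]=E_1-\alpha E_2$, $[E_3,E_1]=\alpha E_1-E_2$. $\mathfrak{g}_{3,5}^{\alpha}\oplus\mathfrak{g}_1$: $[E_2,E_3]=E_1-\alpha E_2$, $[E_3,E_1]=\alpha E_1+E_2$. $\mathfrak{g}_{3,6}\oplus\mathfrak{g}_1$: $[E_2,E_3]=E_1$, $[E_3,E_1]=E_2$, $[E_1,E_2]=-E_3$. $\mathfrak{g}_{3,7}\oplus\mathfrak{g}_1$: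 $[E_2,E_3]=E_1$, $[E_3,E_1]=E_2$, $[E_1,E_2]=E_3$. $\mathfrak{g}_{4,1}$: $[E_2,E_4]=E_1$, $[E_3,E_4]=E_2$. $\mathfrak{g}_{4,2}^{\alpha}$: $[E_1,E_4]=\alpha E_1$, $[E_2,E_4]=E_2$, $[E_3,E_4]=E_2+E_3$. $\mathfrak{g}_{4,3}$: $[E_1,E_4]=E_1$, $[E_3,E_4]=E_2$. $\mathfrak{g}_{4,4}$: $[E_1,E_4]=E_1$, $[E_2,E_4]=E_1+E_2$, $[E_3,E_4]=E_2+E_3$. $\mathfrak{g}_{4,5}^{\alpha,\beta}$: $[E_1,E_4]=E_1$, $[E_2,E_4]=\beta E_2$, $[E_3,E_4]=\alpha E_3$. $\mathfrak{g}_{4,6}^{\alpha,\beta}$: $[E_1,E_4]=\alpha E_1$, $[E_2,E_4]=\beta E_2-E_3$, $[E_3,E_4]=E_2+\beta E_3$. $\mathfrak{g}_{4,7}$: $[E_1,E_4]=2E_1$, $[E_2,E_4]=E_2$, $[E_3,E_4]=E_2+E_3$, $[E_2,E_3]=E_1$. $\mathfrak{g}_{4,8}^{\alpha}$ ($-1\le\alpha\le1$): $[E_1,E_4]=(1+\alpha)E_1$, $[E_2,E_4]=E_2$, $[E_3,E_4]=\alpha E_3$, $[E_2,E_3]=E_1$. $\mathfrak{g}_{4,9}^{\alpha}$: $[E_1,E_4]=2\alpha E_1$, $[E_2,E_4]=\alpha E_2-E_3$, $[E_3,E_4]=E_2+\alpha E_3$, $[E_2,E_3]=E_1$. *)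

(* Defs.v *)
(* MathComp world; the real numbers are an arbitrary [R : realType]. *)
From HB Require Import structures.
From mathcomp Require Import all_boot all_order all_algebra.
From mathcomp Require Import reals.

Set Implicit Arguments.
Unset Strict Implicit.
Unset Printing Implicit Defensive.

Import Order.TTheory GRing.Theory Num.Theory.

Local Open Scope ring_scope.

HB.mixin Record Vector_isLieAlgebra (F : fieldType) L of Vector F L := {
  lie : L -> L -> L;
  lieDZl : forall (a : F) (x y z : L),
    lie (a *: x + y) z = a *: lie x z + lie y z;
  lieDZr : forall (a : F) (x y z : L),
    lie z (a *: x + y) = a *: lie z x + lie z y;
  liexx : forall x : L, lie x x = 0;
  lie_jacobi : forall x y z : L,
    lie x (lie y z) + lie y (lie z x) + lie z (lie x y) = 0
}.

(* Finite-dimensional Lie algebras over F. *)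
#[short(type="lieAlgType")]
HB.structure Definition LieAlgebra (F : fieldType) :=
  { L of Vector F L & Vector_isLieAlgebra F L }.

Notation "[ 'lie' x , y ]" := (lie x y)
  (at level 0, format "[ 'lie'  x ,  y ]") : ring_scope.

Section LieNotions.
Variables (F : fieldType) (L : lieAlgType F).
Implicit Types (q S I : {vspace L}) (x y : L).

Definition is_lie_subalgebra S :=
  forall x y, x \in S -> y \in S -> [lie x, y] \in S.

Definition is_least_lie_subalgebra q S :=
  [/\ is_lie_subalgebra S, (q <= S)%VS &
      forall S', is_lie_subalgebra S' -> (q <= S')%VS -> (S <= S')%VS].

Definition generates q := is_least_lie_subalgebra q fullv.

Definition generating3 q := \dim q = 3%N /\ generates q.

Definition central x := forall y, [lie x, y] = 0.

Definition contains_center q := forall x, central x -> x \in q.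

Definition is_lie_ideal I := forall x y, x \in I -> [lie x, y] \in I.

Definition contains_1dim_ideal q :=
  exists I, [/\ is_lie_ideal I, \dim I = 1%N & (I <= q)%VS].

Definition contains_1dim_noncentral_ideal q :=
  exists I, [/\ is_lie_ideal I, \dim I = 1%N,
                ~ (forall x, x \in I -> central x) & (I <= q)%VS].

Definition collinear x y :=
  exists (v : L) (a b : F), x = a *: v /\ y = b *: v.

Definition frame e1 e2 e3 : 4.-tuple L := [tuple e1; e2; e3; [lie e1, e3]].

(* C_ij^k in the basis (e1, e2, e3, e4 = [e1, e3]); the indices i, j, k are
   1-based, so they are meant to range over 1, ..., 4. *)
Definition struct_const e1 e2 e3 (i j k : nat) : F :=
  let e := frame e1 e2 e3 in
  coord e (inord k.-1) [lie e`_(i.-1), e`_(j.-1)].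

Definition adapted_basis q e1 e2 e3 :=
  [/\ basis_of q [:: e1; e2; e3],
      basis_of fullv (frame e1 e2 e3),
      struct_const e1 e2 e3 1 2 4 = 0 &
      struct_const e1 e2 e3 2 3 4 = 0].

(* The listed conditions are exhaustive on the three-dimensional generating
   subspaces, and each of them occurs; they need not be mutually exclusive. *)
Definition possible_cases2 (P1 P2 : {vspace L} -> Prop) :=
  [/\ forall q, generating3 q -> P1 q \/ P2 q,
      exists2 q, generating3 q & P1 q &
      exists2 q, generating3 q & P2 q].

Definition possible_cases3 (P1 P2 P3 : {vspace L} -> Prop) :=
  [/\ forall q, generating3 q -> [\/ P1 q, P2 q | P3 q],
      exists2 q, generating3 q & P1 q,
      exists2 q, generating3 q & P2 q &
      exists2 q, generating3 q & P3 q].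

(* (E1, E2, E3, E4) is a basis of L with the commutators
   b12 = [E1, E2], b23 = [E2, E3], b31 = [E3, E1] (note the order of the
   arguments in the last one) and b14, b24, b34 = [E1, E4], [E2, E4], [E3, E4]. *)
Definition lie_basis (E1 E2 E3 E4 b12 b23 b31 b14 b24 b34 : L) :=
  basis_of fullv [:: E1; E2; E3; E4] /\
  [/\ [lie E1, E2] = b12, [lie E2, E3] = b23 & [lie E3, E1] = b31] /\
  [/\ [lie E1, E4] = b14, [lie E2, E4] = b24 & [lie E3, E4] = b34].

End LieNotions.

(* [is_g... E1 E2 E3 E4]: L is the named algebra, with (E1, ..., E4) as its
   standard basis. *)
Section FourDimensionalAlgebras.
Variables (F : fieldType) (L : lieAlgType F).
Variables (alpha beta : F) (E1 E2 E3 E4 : L).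

Local Notation table := (lie_basis E1 E2 E3 E4).

(* First row: [E1,E2] [E2,E3] [E3,E1]; second row: [E1,E4] [E2,E4] [E3,E4]. *)
Definition is_2g21 := table
  E1 0 0
  0 0 E3.
Definition is_g32_g1 := table
  0 (E1 - E2) E1
  0 0 0.
Definition is_g34_g1 := table
  0 (E1 - alpha *: E2) (alpha *: E1 - E2)
  0 0 0.
Definition is_g35_g1 := table
  0 (E1 - alpha *: E2) (alpha *: E1 + E2)
  0 0 0.
Definition is_g36_g1 := table
  (- E3) E1 E2
  0 0 0.
Definition is_g37_g1 := table
  E3 E1 E2
  0 0 0.
Definition is_g41 := table
  0 0 0
  0 E1 E2.
Definition is_g42 := table
  0 0 0
  (alpha *: E1) E2 (E2 + E3).
Definition is_g43 := table
  0 0 0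
  E1 0 E2.
Definition is_g44 := table
  0 0 0
  E1 (E1 + E2) (E2 + E3).
Definition is_g45 := table
  0 0 0
  E1 (beta *: E2) (alpha *: E3).
Definition is_g46 := table
  0 0 0
  (alpha *: E1) (beta *: E2 - E3) (E2 + beta *: E3).
Definition is_g47 := table
  0 E1 0
  (2 *: E1) E2 (E2 + E3).
Definition is_g48 := table
  0 E1 0
  ((1 + alpha) *: E1) E2 (alpha *: E3).
Definition is_g49 := table
  0 E1 0
  ((2 * alpha) *: E1) (alpha *: E2 - E3) (E2 + alpha *: E3).

End FourDimensionalAlgebras.

(* Main.v *)
Require Import Defs.
From HB Require Import structures.
From mathcomp Require Import all_boot all_order all_algebra.
From mathcomp Require Import boolp reals ring lra.

Set Implicit Arguments.
Unset Strict Implicit.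
Unset Printing Implicit Defensive.

Import Order.TTheory GRing.Theory Num.Theory.

Local Open Scope ring_scope.

(* A three-dimensional subspace q generates the Lie algebra iff it is not a
   subalgebra, and then (x, y) |-> [x, y] mod q is a nonzero alternating form on
   q with values in a line. Its kernel is a line <k>, and (e1, e2, e3) is an
   adapted basis of q exactly when e2 spans this kernel; a one-dimensional ideal
   contained in q is the kernel as well. Everything is then read off the
   action of k on q.
   If there is an abelian ideal A of dimension 3, then k lies in A; either <k>
   is an ideal, or (t, k, [t, k]) is an adapted basis for t in q outside A. In
   the other algebras k is computed from an equation of q. *)

(** The kernel is nonzero because an alternating form on a space of odd dimension is degenerate. The
    listed conditions are the possible shapes of its action. Over an abelian ideal of codimension
    one, let D be the action of a complementary vector. If [k] is an eigenvector of D, it spans an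
    ideal, central when the eigenvalue is 0. Otherwise [k] and D k span the intersection of the
    ideal with [q], and D^2 k leaves [q], so [k] is a cyclic vector of D. Over a Heisenberg ideal,
    the matrix of the action modulo the center of the ideal decides: its trace tells whether that
    center is central in the whole algebra, and Cayley-Hamilton turns its determinant into C_23^1.
    Over a simple ideal of dimension 3, the projection of [k] to the ideal is null or not for the
    invariant quadratic form; a definite form leaves only the second possibility. For the occurrence
    of each case, [q] is given as the kernel of an explicit linear form. *)

Lemma eq_linear_forms (F : fieldType) (V : vectType F) (u v : V) :
  (forall g : V -> F, {morph g : x y / x + y} -> {morph g : x / - x} ->
     g 0 = 0 -> (forall a x, g (a *: x) = a * g x) -> g u = g v) -> u = v.
Proof.
move=> eq_uv; rewrite (coord_vbasis (memvf u)) (coord_vbasis (memvf v)).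
apply: eq_bigr => i _; congr (_ *: _); apply: eq_uv.
- exact: linearD.
- exact: linearN.
- exact: linear0.
- by move=> a x; rewrite linearZ.
Qed.

(* Linear identities between vectors, by reduction to [ring] on the values of
   an arbitrary linear form. *)
Ltac module :=
  let g := fresh "g" in let gD := fresh "gD" in let gN := fresh "gN" in
  let g0 := fresh "g0" in let gZ := fresh "gZ" in
  apply: eq_linear_forms => g gD gN g0 gZ; rewrite ?(gD, gN, g0, gZ); ring.

(** * Brackets, hyperplanes and generation *)

Section LieTheory.
Variables (F : fieldType) (L : lieAlgType F).
Implicit Types (x y z : L) (q : {vspace L}).

Lemma lieDl x y z : [lie x + y, z] = [lie x, z] + [lie y, z].
Proof. by rewrite -[x]scale1r lieDZl !scale1r. Qed.

Lemma lieDr x y z : [lie z, x + y] = [lie z, x] + [lie z, y].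
Proof. by rewrite -[x]scale1r lieDZr !scale1r. Qed.

Lemma lie0l x : [lie 0, x] = 0.
Proof. by apply: (addrI [lie 0, x]); rewrite -lieDl !addr0. Qed.

Lemma lie0r x : [lie x, 0] = 0.
Proof. by apply: (addrI [lie x, 0]); rewrite -lieDr !addr0. Qed.

Lemma lieZl (a : F) x y : [lie a *: x, y] = a *: [lie x, y].
Proof. by rewrite -[a *: x]addr0 lieDZl lie0l addr0. Qed.

Lemma lieZr (a : F) x y : [lie x, a *: y] = a *: [lie x, y].
Proof. by rewrite -[a *: y]addr0 lieDZr lie0r addr0. Qed.

Lemma lieC x y : [lie x, y] = - [lie y, x].
Proof.
apply/eqP; rewrite -addr_eq0; apply/eqP.
by have := liexx (x + y); rewrite lieDl !lieDr !liexx add0r addr0.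
Qed.

Lemma lieNl x y : [lie - x, y] = - [lie x, y].
Proof. by rewrite -scaleN1r lieZl scaleN1r. Qed.

Lemma lieNr x y : [lie x, - y] = - [lie x, y].
Proof. by rewrite -scaleN1r lieZr scaleN1r. Qed.

Lemma memv_lieC q x y : ([lie x, y] \in q) = ([lie y, x] \in q).
Proof. by rewrite lieC rpredN. Qed.

Lemma is_lie_ideal_line k :
  (forall y, exists c, [lie k, y] = c *: k) -> is_lie_ideal <[k]>.
Proof.
move=> ideal_k x y /vlineP[a ->]; have [c eq_ky] := ideal_k y.
by rewrite lieZl eq_ky scalerA memvZ ?memv_line.
Qed.

Lemma contains_1dim_noncentral_idealI q k :
  k \in q -> is_lie_ideal <[k]> -> ~ central k ->
  contains_1dim_noncentral_ideal q.
Proof.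
move=> qk ideal_k ncentral_k; exists <[k]>%VS; split=> //.
- rewrite dim_vline; case: eqP ncentral_k => // -> []; exact: lie0l.
- by move=> central_line; apply/ncentral_k/central_line/memv_line.
Qed.

Section Hyperplane.
Hypothesis dimL : \dim {:L} = 4%N.

(** Any vector outside a hyperplane spans a complement; this is what turns a bracket modulo [q] into
    a scalar. *)
Lemma hyperplane_decomp q u v : \dim q = 3%N -> u \notin q ->
  exists c, v - c *: u \in q.
Proof.
move=> dimq qNu; have : v \in (q + <[u]>)%VS.
  suff -> : (q + <[u]>)%VS = fullv by exact: memvf.
  apply/eqP; rewrite eqEdim subvf dimL /= dimv_disjoint_sum ?dimq.
    by rewrite dim_vline; case: eqP qNu => // ->; rewrite mem0v.
  apply/eqP; rewrite -subv0; apply/subvP => w /memv_capP[qw /vlineP[c def_w]].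
  by move: qw; rewrite def_w rpredZeq (negPf qNu) orbF => /eqP->; rewrite scale0r mem0v.
by case/memv_addP => w qw [_ /vlineP[c ->] ->]; exists c; rewrite addrK.
Qed.

Variable q : {vspace L}.
Hypothesis dimq : \dim q = 3%N.

(** A subalgebra containing [q] contains the bracket that leaves [q], and a hyperplane together with
    one outside vector spans everything. *)
Lemma generating3P :
  generating3 q <-> exists x y, [/\ x \in q, y \in q & [lie x, y] \notin q].
Proof.
split=> [[_ [_ _ least_full]] | [x [y [qx qy qNxy]]]].
  apply: contrapT => sub_q; have /dimvS : (fullv <= q)%VS; last by rewrite dimL dimq.
  apply: least_full => // x y qx qy.
  by apply: contrapT => /negP qNxy; apply: sub_q; exists x, y.
split=> //; split=> [||S subS sub_qS]; rewrite ?subvf //.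
  by move=> *; exact: memvf.
apply/subvP => v _; have [c def_v] := hyperplane_decomp v dimq qNxy.
rewrite -(subrK (c *: [lie x, y]) v); apply: memvD; first exact: (subvP sub_qS).
by apply/memvZ/subS; apply: (subvP sub_qS).
Qed.

(** * Adapted bases around a kernel vector [e2] *)

Section Adapted.
Variables e1 e2 e3 : L.
Hypotheses (qe1 : e1 \in q) (qe2 : e2 \in q) (qe3 : e3 \in q).
Hypotheses (nz_e2 : e2 != 0) (q12 : [lie e1, e2] \in q).
Hypotheses (q23 : [lie e2, e3] \in q) (qN13 : [lie e1, e3] \notin q).

(** In a linear relation bracketed with [e1], only the multiple of [[e1, e3]] can leave [q], so the
    coefficient of [e3] vanishes; bracketing with [e3] removes that of [e1]. *)
Lemma adapted_free : free [:: e1; e2; e3].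
Proof.
apply/(@freeP _ _ _ [tuple e1; e2; e3]) => k.
rewrite !big_ord_recl big_ord0 /= addr0.
set a := k _; set b := k _; set c := k _ => rel.
have c0 : c = 0.
  apply/eqP; move: (congr1 (lie e1) rel); rewrite !lieDr !lieZr liexx lie0r.
  rewrite scaler0 add0r => /eqP; rewrite addrC addr_eq0 => /eqP def13.
  have : c *: [lie e1, e3] \in q by rewrite def13 rpredN memvZ.
  by rewrite rpredZeq (negPf qN13) orbF.
have a0 : a = 0.
  apply/eqP; move: (congr1 (lie^~ e3) rel).
  rewrite !lieDl !lieZl c0 scale0r addr0 lie0l => /eqP; rewrite addr_eq0 => /eqP def13.
  have : a *: [lie e1, e3] \in q by rewrite def13 rpredN memvZ.
  by rewrite rpredZeq (negPf qN13) orbF.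
have b0 : b = 0.
  move/eqP: rel; rewrite a0 c0 !scale0r add0r addr0 scaler_eq0 (negPf nz_e2).
  by rewrite orbF => /eqP.
move=> i; case: (unliftP ord0 i) => [j ->|-> //].
case: (unliftP ord0 j) => [l ->|-> //].
by case: (unliftP ord0 l) => [[]|-> //].
Qed.

Lemma adapted_basis_of : basis_of q [:: e1; e2; e3].
Proof.
rewrite basisEfree adapted_free dimq /= andbT.
by apply/span_subvP => x; rewrite !inE => /or3P[] /eqP->.
Qed.

Lemma adapted_frame : basis_of fullv (frame e1 e2 e3).
Proof.
have e_q := span_basis adapted_basis_of.
rewrite (@perm_basis _ _ _ ([lie e1, e3] :: [:: e1; e2; e3])); last first.
  exact/permPl/(perm_rot 1 [:: [lie e1, e3]; e1; e2; e3]).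
by rewrite basisEfree free_cons e_q qN13 adapted_free subvf dimL.
Qed.

Lemma struct_const23E a b c :
    [lie e2, e3] = a *: e1 + b *: e2 + c *: e3 ->
  struct_const e1 e2 e3 2 3 1 = a /\ struct_const e1 e2 e3 2 3 2 = b.
Proof.
move=> def23; pose k (i : 'I_4) := nth 0 [:: a; b; c; 0] i.
have sum23 : [lie e2, e3] = \sum_(i < 4) k i *: (frame e1 e2 e3)`_i.
  by rewrite !big_ord_recl big_ord0 /= scale0r !addr0 def23 !addrA.
have free_e := basis_free adapted_frame.
by rewrite /struct_const /= sum23 !coord_sum_free // /k !inordK.
Qed.

Lemma adapted_basisI : adapted_basis q e1 e2 e3.
Proof.
have free_e := basis_free adapted_frame.
(* Index 3 is the fourth vector [[e1, e3]] of the frame, so this coordinate is zero on the span of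
   the other three; both required structure constants are values of it. *)
have coord4 v : v \in q -> coord (frame e1 e2 e3) (inord 3) v = 0.
  move=> qv; rewrite (@coord_basis _ _ _ _ [tuple e1; e2; e3] _ adapted_basis_of qv).
  rewrite linear_sum big1 // => i _; rewrite linearZ /=.
  have -> : [:: e1; e2; e3]`_i = (frame e1 e2 e3)`_(widen_ord (leqnSn 3) i).
    by case: i => [[|[|[]]]].
  rewrite coord_free // -val_eqE /= inordK // (ltn_eqF (ltn_ord i)).
  exact: mulr0.
by split; rewrite ?adapted_basis_of ?adapted_frame // /struct_const coord4.
Qed.

Lemma adapted_decomp v : v \in q -> exists a b c, v = a *: e1 + b *: e2 + c *: e3.
Proof.
rewrite -(span_basis adapted_basis_of) !span_cons span_nil.
case/memv_addP=> _ /vlineP[a ->] [_ /memv_addP[_ /vlineP[b ->] [w qw ->]] ->].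
case/memv_addP: qw => _ /vlineP[c ->] [_ /[!memv0]/eqP-> ->].
by exists a, b, c; rewrite addr0 addrA.
Qed.

End Adapted.

(** With [[x, y]] as unit of the quotient by [q], a third vector [z] is corrected by multiples of
    [x] and [y] until its brackets with both fall into [q]. The result is nonzero because [z] is not
    in the span of [x] and [y]. *)
Lemma lie_kernel :
  generating3 q ->
  exists k, [/\ k \in q, k != 0 & forall x, x \in q -> [lie k, x] \in q].
Proof.
case/generating3P => x [y [qx qy qNxy]].
have [z qz xyNz] : exists2 z, z \in q & z \notin <<[:: x; y]>>%VS.
  have /subvPn[z qz xyNz] : ~~ (q <= <<[:: x; y]>>)%VS; last by exists z.
  by apply: contraL (dim_span [:: x; y]) => /dimvS; rewrite dimq -ltnNge.
have [a qxz] := hyperplane_decomp [lie x, z] dimq qNxy.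
have [b qyz] := hyperplane_decomp [lie y, z] dimq qNxy.
pose k := z - a *: y + b *: x.
have qk : k \in q by rewrite memvD ?memvB ?memvZ.
have nz_k : k != 0.
  apply: contraNneq xyNz => k0.
  have -> : z = a *: y - b *: x.
    by apply/eqP; rewrite -subr_eq0 opprB addrCA addrC -k0.
  by rewrite memvB ?memvZ ?memv_span ?inE ?eqxx ?orbT.
have qxk : [lie x, k] \in q.
  by rewrite !lieDr lieNr !lieZr liexx scaler0 addr0.
have qky : [lie k, y] \in q.
  rewrite memv_lieC !lieDr lieNr !lieZr liexx scaler0 subr0.
  by rewrite [ [lie y, x] ]lieC scalerN.
(* The vectors [x], [k], [y] satisfy the hypotheses of an adapted basis, so testing [k] on them is
   enough. *)
exists k; split=> // v qv.
have [c [d [e ->]]] := adapted_decomp qx qk qy nz_k qxk qky qNxy qv.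
by rewrite !lieDr !lieZr liexx scaler0 addr0 memvD // memvZ // memv_lieC.
Qed.

(** * Abelian ideals of codimension one *)

Section AbelianIdeal.
Variable A : {vspace L}.
Hypothesis dimA : \dim A = 3%N.
Hypothesis lieAA : forall x y, x \in A -> y \in A -> [lie x, y] = 0.
Hypothesis ideal_A : is_lie_ideal A.

Lemma abelian_ideal_cases :
  generating3 q ->
  (exists k, [/\ k \in A, k \in q, k != 0 & is_lie_ideal <[k]> ]) \/
  exists e1 e2 e3, [/\ adapted_basis q e1 e2 e3,
    e3 = [lie e1, e2] & [lie e2, e3] = 0].
Proof.
move=> gen_q; have [k [qk nz_k ker_k]] := lie_kernel gen_q.
have ker_k' x : x \in q -> [lie x, k] \in q by move=> qx; rewrite memv_lieC ker_k.
(* Of two vectors of [q] whose bracket leaves [q], one lies outside the abelian [A]; subtracting a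
   multiple of it moves the other into [A] if needed, and the bracket changes at most in sign. *)
have [t [w [qt AN_t qw Aw qNtw]]] : 

  exists t w, [/\ t \in q, t \notin A, w \in q, w \in A & [lie t, w] \notin q].
  have [x [y [qx qy qNxy]]] := (generating3P.1 gen_q).
  have [Ax | ANx] := boolP (x \in A); last first.
    have [c Aw] := hyperplane_decomp y dimA ANx; exists x, (y - c *: x).
    split=> //; first by rewrite memvB ?memvZ.
    by rewrite lieDr lieNr lieZr liexx scaler0 subr0.
  have ANy : y \notin A.
    by apply: contraNN qNxy => Ay; rewrite lieAA ?mem0v.
  by exists y, x; split; rewrite // memv_lieC.
(* The vector [k - c *: t] of [A] commutes with [w], so [[k, w] = c *: [t, w]]; this lies in [q]
   only for [c = 0]. *)
have [c Ak'] := hyperplane_decomp k dimA AN_t.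
have Ak : k \in A.
  suff c0 : c = 0 by rewrite c0 scale0r subr0 in Ak'.
  apply/eqP; have := lieAA Ak' Aw; rewrite lieDl lieNl lieZl => /eqP.
  rewrite subr_eq0 => /eqP def_kw; have := ker_k w qw.
  by rewrite def_kw rpredZeq (negPf qNtw) orbF.
have Au : [lie t, k] \in A by rewrite memv_lieC ideal_A.
(* Since [A] is abelian and [t] spans a complement of it, [[t, k]] alone decides whether [<[k]>] is
   an ideal. *)
have [/vlineP[l def_u] | kNu] := boolP ([lie t, k] \in <[k]>%VS).
  left; exists k; split=> //; apply: is_lie_ideal_line => y.
  have [d Ay'] := hyperplane_decomp y dimA AN_t; exists (- (d * l)).
  rewrite -[y in LHS](subrK (d *: t)) lieDr lieAA // add0r lieZr lieC def_u.
  by rewrite scalerN scalerA scaleNr.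
right; exists t, k, [lie t, k]; split=> //; last exact: lieAA.
apply: adapted_basisI => //; rewrite ?ker_k ?ker_k' //.
(* As [[t, k]] lies in [A] but not in [<[k]>], it has no [t]-component and a nonzero [w]-component;
   hence [[t, [t, k]]] leaves [q] together with [[t, w]]. *)
have [|a [b [d def_u]]] := adapted_decomp qt qk qw nz_k (ker_k' _ qt)
  (ker_k _ qw) qNtw (v := [lie t, k]).
  exact: ker_k'.
have a0 : a = 0.
  apply/eqP; have : a *: t \in A.
    by rewrite -[_ *: t](addrK (b *: k + d *: w)) addrA -def_u memvB // memvD ?memvZ.
  by rewrite rpredZeq (negPf AN_t) orbF.
have nz_d : d != 0.
  apply: contraNneq kNu => d0; rewrite def_u a0 d0 !scale0r add0r addr0.
  by rewrite memvZ ?memv_line.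
rewrite def_u a0 scale0r add0r lieDr !lieZr rpredDl ?rpredZeq ?(negPf nz_d) //.
by rewrite ker_k' ?orbT.
Qed.

End AbelianIdeal.

End Hyperplane.
End LieTheory.

(** * Coordinates and equations of hyperplanes *)

Section Coordinates.
Variables (F : fieldType) (L : lieAlgType F) (E1 E2 E3 E4 : L).

Definition vec4 (x1 x2 x3 x4 : F) : L :=
  x1 *: E1 + x2 *: E2 + x3 *: E3 + x4 *: E4.

Lemma vec4D x1 x2 x3 x4 y1 y2 y3 y4 :
  vec4 x1 x2 x3 x4 + vec4 y1 y2 y3 y4 =
  vec4 (x1 + y1) (x2 + y2) (x3 + y3) (x4 + y4).
Proof. by rewrite /vec4; module. Qed.

Lemma vec4Z a x1 x2 x3 x4 :
  a *: vec4 x1 x2 x3 x4 = vec4 (a * x1) (a * x2) (a * x3) (a * x4).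
Proof. by rewrite /vec4 !scalerDr !scalerA. Qed.

Lemma vec4N x1 x2 x3 x4 : - vec4 x1 x2 x3 x4 = vec4 (- x1) (- x2) (- x3) (- x4).
Proof. by rewrite -scaleN1r vec4Z !mulN1r. Qed.

Lemma vec4_0 : vec4 0 0 0 0 = 0.
Proof. by rewrite /vec4 !scale0r !addr0. Qed.

Lemma vec4_E4 : E4 = vec4 0 0 0 1.
Proof. by rewrite /vec4 !scale0r scale1r !add0r. Qed.

Lemma lie_vec4 x1 x2 x3 x4 y1 y2 y3 y4 :
  [lie vec4 x1 x2 x3 x4, vec4 y1 y2 y3 y4] =
    (x1 * y2 - x2 * y1) *: [lie E1, E2] + (x2 * y3 - x3 * y2) *: [lie E2, E3]
  + (x3 * y1 - x1 * y3) *: [lie E3, E1] + (x1 * y4 - x4 * y1) *: [lie E1, E4]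
  + (x2 * y4 - x4 * y2) *: [lie E2, E4] + (x3 * y4 - x4 * y3) *: [lie E3, E4].
Proof.
rewrite /vec4 !(lieDl, lieDr, lieZl, lieZr) !liexx.
rewrite [ [lie E2, E1] ]lieC [ [lie E3, E2] ]lieC [ [lie E1, E3] ]lieC.
by rewrite [ [lie E4, E1] ]lieC [ [lie E4, E2] ]lieC [ [lie E4, E3] ]lieC; module.
Qed.

Hypothesis basisE : basis_of fullv [:: E1; E2; E3; E4].

Lemma vec4_surj v : exists x1 x2 x3 x4, v = vec4 x1 x2 x3 x4.
Proof.
have := memvf v; rewrite -(span_basis basisE) !span_cons span_nil.
case/memv_addP=> _ /vlineP[x1 ->] [_ /memv_addP[_ /vlineP[x2 ->] [w Uw ->]] ->].
case/memv_addP: Uw => _ /vlineP[x3 ->] [_ /memv_addP[_ /vlineP[x4 ->] [r Ur ->]] ->].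
move: Ur => /[!memv0]/eqP ->; exists x1, x2, x3, x4.
by rewrite addr0 /vec4 !addrA.
Qed.

Lemma vec4_eq0 x1 x2 x3 x4 :
  vec4 x1 x2 x3 x4 = 0 -> [/\ x1 = 0, x2 = 0, x3 = 0 & x4 = 0].
Proof.
move=> V0; pose k (i : 'I_4) := nth 0 [:: x1; x2; x3; x4] i.
have := @freeP _ _ _ [tuple E1; E2; E3; E4] (basis_free basisE) k.
rewrite !big_ord_recl big_ord0 addr0 /= /k /= !addrA => /(_ V0) k0.
by split; [have := k0 (inord 0)|have := k0 (inord 1)|have := k0 (inord 2)
  |have := k0 (inord 3)]; rewrite inordK.
Qed.

Lemma dim_basis4 : \dim {:L} = 4%N.
Proof. exact: (@size_basis _ _ _ _ [tuple E1; E2; E3; E4] basisE). Qed.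

(** The coefficients are those of the basis vectors, modulo [q], along one fixed vector [u] outside
    [q]. *)
Lemma hyperplane_equation (q : {vspace L}) : \dim q = 3%N ->
  exists a1 a2 a3 a4, forall x1 x2 x3 x4,
    (vec4 x1 x2 x3 x4 \in q) = (a1 * x1 + a2 * x2 + a3 * x3 + a4 * x4 == 0).
Proof.
move=> dimq; have /subvPn[u _ qNu] : ~~ ({:L} <= q)%VS.
  by apply/negP => /dimvS; rewrite dim_basis4 dimq.
have [a1 q1] := hyperplane_decomp dim_basis4 E1 dimq qNu.
have [a2 q2] := hyperplane_decomp dim_basis4 E2 dimq qNu.
have [a3 q3] := hyperplane_decomp dim_basis4 E3 dimq qNu.
have [a4 q4] := hyperplane_decomp dim_basis4 E4 dimq qNu.
exists a1, a2, a3, a4 => x1 x2 x3 x4.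
have -> : vec4 x1 x2 x3 x4 = (x1 *: (E1 - a1 *: u) + x2 *: (E2 - a2 *: u)
    + x3 *: (E3 - a3 *: u) + x4 *: (E4 - a4 *: u))
    + (a1 * x1 + a2 * x2 + a3 * x3 + a4 * x4) *: u.
  by rewrite /vec4; module.
rewrite rpredDl; last by rewrite !memvD ?memvZ.
by rewrite rpredZeq (negPf qNu) orbF.
Qed.

Lemma hyperplane_exists a1 a2 a3 a4 :
    [|| a1 != 0, a2 != 0, a3 != 0 | a4 != 0] ->
  exists2 q : {vspace L}, \dim q = 3%N & forall x1 x2 x3 x4,
    (vec4 x1 x2 x3 x4 \in q) = (a1 * x1 + a2 * x2 + a3 * x3 + a4 * x4 == 0).
Proof.
move=> nz_a; pose X := [tuple E1; E2; E3; E4].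
pose a (i : 'I_4) := nth 0 [:: a1; a2; a3; a4] i.
pose f : 'Hom(L, F^o) := \sum_(i < 4) a i *: linfun (coord X i : L -> F^o).
have freeX : free X := basis_free basisE.
have fE x1 x2 x3 x4 : f (vec4 x1 x2 x3 x4) = a1 * x1 + a2 * x2 + a3 * x3 + a4 * x4.
  pose x (i : 'I_4) := nth 0 [:: x1; x2; x3; x4] i.
  have -> : vec4 x1 x2 x3 x4 = \sum_(i < 4) x i *: X`_i.
    by rewrite !big_ord_recl big_ord0 addr0 /= /x /= !addrA.
  rewrite sum_lfunE (eq_bigr (fun i => a i * x i)) => [|i _]; last first.
    by rewrite scale_lfunE lfunE /= coord_sum_free.
  by rewrite !big_ord_recl big_ord0 addr0 /= /x /a /= !addrA.
exists (lker f); last by move=> x1 x2 x3 x4; rewrite memv_ker fE.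
have := limg_ker_dim f fullv; rewrite capfv dim_basis4.
suff -> : \dim (f @: fullv) = 1%N by rewrite addn1 => -[].
apply/eqP; rewrite eqn_leq; apply/andP; split.
  by have := dimvS (subvf (f @: fullv)); rewrite dimvf.
rewrite lt0n dimv_eq0; apply: contraL nz_a => /eqP f0.
have {}f0 x1 x2 x3 x4 : a1 * x1 + a2 * x2 + a3 * x3 + a4 * x4 = 0.
  by have := memv_img f (memvf (vec4 x1 x2 x3 x4)); rewrite f0 memv0 fE => /eqP.
rewrite !negb_or !negbK; apply/and4P; split; apply/eqP;
[rewrite -(f0 1 0 0 0) | rewrite -(f0 0 1 0 0)
| rewrite -(f0 0 0 1 0) | rewrite -(f0 0 0 0 1)]; ring.
Qed.

End Coordinates.

(** * One vector [T] acting on a three-dimensional abelian ideal *)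

Section AbelianFamily.
Variables (F : fieldType) (L : lieAlgType F) (A1 A2 A3 T : L).
Local Notation V := (vec4 A1 A2 A3 T).
Variables m11 m12 m13 m21 m22 m23 m31 m32 m33 : F.
Hypothesis table : lie_basis A1 A2 A3 T 0 0 0
  (V m11 m12 m13 0) (V m21 m22 m23 0) (V m31 m32 m33 0).

Let basisA : basis_of fullv [:: A1; A2; A3; T] := table.1.
Let dimL : \dim {:L} = 4%N := dim_basis4 basisA.

(** Together [ad1], [ad2], [ad3] are the coordinates of the bracket of x with [T]: the row vector x
    times the matrix m, whose rows are the brackets of [A1], [A2], [A3] with [T]. *)
Let ad1 x1 x2 x3 := x1 * m11 + x2 * m21 + x3 * m31.
Let ad2 x1 x2 x3 := x1 * m12 + x2 * m22 + x3 * m32.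
Let ad3 x1 x2 x3 := x1 * m13 + x2 * m23 + x3 * m33.

Lemma lie_abelian x1 x2 x3 x4 y1 y2 y3 y4 :
  [lie V x1 x2 x3 x4, V y1 y2 y3 y4] =
  V (y4 * ad1 x1 x2 x3 - x4 * ad1 y1 y2 y3)
    (y4 * ad2 x1 x2 x3 - x4 * ad2 y1 y2 y3)
    (y4 * ad3 x1 x2 x3 - x4 * ad3 y1 y2 y3) 0.
Proof.
case: table => _ [[b12 b23 b31] [b14 b24 b34]].
rewrite lie_vec4 b12 b23 b31 b14 b24 b34 /vec4 /ad1 /ad2 /ad3; module.
Qed.

Lemma abelian_cases (q : {vspace L}) : generating3 q ->
  (exists k1 k2 k3 c, [/\ V k1 k2 k3 0 \in q, V k1 k2 k3 0 != 0 &
     [/\ ad1 k1 k2 k3 = c * k1, ad2 k1 k2 k3 = c * k2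
       & ad3 k1 k2 k3 = c * k3]]) \/
  exists e1 e2 e3, [/\ adapted_basis q e1 e2 e3,
    e3 = [lie e1, e2] & [lie e2, e3] = 0].
Proof.
move=> gen_q; have dimq := gen_q.1.
have [|A dimA memA] := @hyperplane_exists _ _ _ _ _ _ basisA 0 0 0 1.
  by rewrite oner_eq0 !orbT.
have memA' x1 x2 x3 x4 : (V x1 x2 x3 x4 \in A) = (x4 == 0).
  by rewrite memA !mul0r !add0r mul1r.
have lieAA x y : x \in A -> y \in A -> [lie x, y] = 0.
  have [x1 [x2 [x3 [x4 ->]]]] := vec4_surj basisA x.
  have [y1 [y2 [y3 [y4 ->]]]] := vec4_surj basisA y.
  rewrite !memA' => /eqP-> /eqP->; rewrite lie_abelian -[RHS](vec4_0 A1 A2 A3 T).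
  by congr vec4; ring.
have ideal_A : is_lie_ideal A.
  move=> x y; have [x1 [x2 [x3 [x4 ->]]]] := vec4_surj basisA x.
  have [y1 [y2 [y3 [y4 ->]]]] := vec4_surj basisA y.
  by rewrite lie_abelian !memA'.
case: (abelian_ideal_cases dimL dimq dimA lieAA ideal_A gen_q); last by right.
case=> k; have [k1 [k2 [k3 [k4 ->]]]] := vec4_surj basisA k.
rewrite memA' => -[/eqP-> qk nz_k /(_ _ (V 0 0 0 1) (memv_line _))].
rewrite lie_abelian => /vlineP[c /eqP]; rewrite -subr_eq0 vec4Z vec4N vec4D.
move=> /eqP/(vec4_eq0 basisA)[eq1 eq2 eq3 _]; left; exists k1, k2, k3, c.
split=> //; split.
- by rewrite -[RHS]addr0 -eq1; ring.
- by rewrite -[RHS]addr0 -eq2; ring.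
- by rewrite -[RHS]addr0 -eq3; ring.
Qed.

Lemma central_abelian x1 x2 x3 x4 : central (V x1 x2 x3 x4) ->
  [/\ ad1 x1 x2 x3 = 0, ad2 x1 x2 x3 = 0 & ad3 x1 x2 x3 = 0]
  /\ forall y1 y2 y3,
     [/\ x4 * ad1 y1 y2 y3 = 0, x4 * ad2 y1 y2 y3 = 0 & x4 * ad3 y1 y2 y3 = 0].
Proof.
move=> cx; split=> [|y1 y2 y3].
  have:= cx (V 0 0 0 1); rewrite lie_abelian => /(vec4_eq0 basisA)[eq1 eq2 eq3 _].
  by split; [rewrite -eq1|rewrite -eq2|rewrite -eq3]; rewrite /ad1 /ad2 /ad3; ring.
have:= cx (V (- y1) (- y2) (- y3) 0).
rewrite lie_abelian => /(vec4_eq0 basisA)[eq1 eq2 eq3 _].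
by split; [rewrite -eq1|rewrite -eq2|rewrite -eq3]; rewrite /ad1 /ad2 /ad3; ring.
Qed.

(** A nonzero value of ad at y kills the [T]-coordinate of a central element; what remains is in the
    kernel of ad, hence on the line of z. *)
Lemma contains_center_abelian (q : {vspace L}) z1 z2 z3 y1 y2 y3 :
    (forall x1 x2 x3, ad1 x1 x2 x3 = 0 -> ad2 x1 x2 x3 = 0 -> ad3 x1 x2 x3 = 0 ->
       exists c, [/\ x1 = c * z1, x2 = c * z2 & x3 = c * z3]) ->
    [|| ad1 y1 y2 y3 != 0, ad2 y1 y2 y3 != 0 | ad3 y1 y2 y3 != 0] ->
    V z1 z2 z3 0 \in q ->
  contains_center q.
Proof.
move=> ker_ad nz_ad qz x; have [x1 [x2 [x3 [x4 ->]]]] := vec4_surj basisA x.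
case/central_abelian=> -[ad1_0 ad2_0 ad3_0] /(_ y1 y2 y3) [y1_0 y2_0 y3_0].
have -> : x4 = 0.
  by case/or3P: nz_ad => nz_ad; apply/eqP; [move/eqP: y1_0 | move/eqP: y2_0
    | move/eqP: y3_0]; rewrite mulf_eq0 (negPf nz_ad) orbF.
have [c [-> -> ->]] := ker_ad _ _ _ ad1_0 ad2_0 ad3_0.
by rewrite -[0](mulr0 c) -vec4Z memvZ.
Qed.

Lemma contains_center_eigenvector (q : {vspace L}) k1 k2 k3 z1 z2 z3 y1 y2 y3 :
    (forall x1 x2 x3, ad1 x1 x2 x3 = 0 -> ad2 x1 x2 x3 = 0 -> ad3 x1 x2 x3 = 0 ->
       exists c, [/\ x1 = c * z1, x2 = c * z2 & x3 = c * z3]) ->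
    [|| ad1 y1 y2 y3 != 0, ad2 y1 y2 y3 != 0 | ad3 y1 y2 y3 != 0] ->
    ad1 k1 k2 k3 = 0 -> ad2 k1 k2 k3 = 0 -> ad3 k1 k2 k3 = 0 ->
    V k1 k2 k3 0 \in q -> V k1 k2 k3 0 != 0 ->
  contains_center q.
Proof.
move=> ker_ad nz_ad ad1_0 ad2_0 ad3_0.
have [c [-> -> ->]] := ker_ad _ _ _ ad1_0 ad2_0 ad3_0.
have -> : V (c * z1) (c * z2) (c * z3) 0 = c *: V z1 z2 z3 0.
  by rewrite vec4Z mulr0.
rewrite rpredZeq scaler_eq0 negb_or.
move=> /[swap] /andP[/negPf-> _] /=.
exact: contains_center_abelian ker_ad nz_ad.
Qed.

Lemma contains_noncentral_abelian (q : {vspace L}) k1 k2 k3 c :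
    ad1 k1 k2 k3 = c * k1 -> ad2 k1 k2 k3 = c * k2 -> ad3 k1 k2 k3 = c * k3 ->
    c != 0 -> V k1 k2 k3 0 \in q -> V k1 k2 k3 0 != 0 ->
  contains_1dim_noncentral_ideal q.
Proof.
move=> eig1 eig2 eig3 nz_c qk nz_k; apply: (contains_1dim_noncentral_idealI qk).
  apply: is_lie_ideal_line => y.
  have [y1 [y2 [y3 [y4 ->]]]] := vec4_surj basisA y; exists (y4 * c).
  by rewrite lie_abelian eig1 eig2 eig3 vec4Z; congr vec4; ring.
case/central_abelian; rewrite eig1 eig2 eig3 => -[k1_0 k2_0 k3_0] _.
case/eqP: nz_k; rewrite -[RHS](vec4_0 A1 A2 A3 T).
by congr vec4; apply: (mulfI nz_c); rewrite mulr0.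
Qed.

(** Here [q] is the kernel of f, extended by 0 on [T], and x is a cyclic vector: f kills x and ad x
    but not ad^2 x. In the applications f is, up to sign, the cross product of x and ad x, so the
    nonzero quantity is, up to sign, the determinant of x, ad x, ad^2 x. *)
Lemma abelian_cyclic x1 x2 x3 f1 f2 f3
    (y1 := ad1 x1 x2 x3) (y2 := ad2 x1 x2 x3) (y3 := ad3 x1 x2 x3) :
    f1 * x1 + f2 * x2 + f3 * x3 = 0 -> f1 * y1 + f2 * y2 + f3 * y3 = 0 ->
    f1 * ad1 y1 y2 y3 + f2 * ad2 y1 y2 y3 + f3 * ad3 y1 y2 y3 != 0 ->
  exists2 q : {vspace L}, generating3 q & exists e1 e2 e3,
    [/\ adapted_basis q e1 e2 e3, e3 = [lie e1, e2] & [lie e2, e3] = 0].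
Proof.
move=> fx fy nz_fz.
have [|q dimq memq] := @hyperplane_exists _ _ _ _ _ _ basisA f1 f2 f3 0.
  apply: contraNT nz_fz; rewrite !negb_or !negbK => /and4P[/eqP-> /eqP-> /eqP-> _].
  by rewrite !mul0r !addr0.
have qT : V 0 0 0 1 \in q by rewrite memq; apply/eqP; ring.
have qx : V x1 x2 x3 0 \in q by rewrite memq mul0r addr0 fx.
have Tx : [lie V 0 0 0 1, V x1 x2 x3 0] = V (- y1) (- y2) (- y3) 0.
  by rewrite lie_abelian; congr vec4; rewrite /y1 /y2 /y3; ring.
have Ty : [lie V 0 0 0 1, V (- y1) (- y2) (- y3) 0] =
    V (ad1 y1 y2 y3) (ad2 y1 y2 y3) (ad3 y1 y2 y3) 0.
  by rewrite lie_abelian; congr vec4; rewrite /ad1 /ad2 /ad3; ring.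
have qy : V (- y1) (- y2) (- y3) 0 \in q.
  by rewrite memq mul0r addr0 !mulrN -!opprD fy oppr0.
have qNz : [lie V 0 0 0 1, V (- y1) (- y2) (- y3) 0] \notin q.
  by rewrite Ty memq mul0r addr0.
have xy : [lie V x1 x2 x3 0, V (- y1) (- y2) (- y3) 0] = 0.
  by rewrite lie_abelian -[RHS](vec4_0 A1 A2 A3 T); congr vec4; ring.
exists q.
  apply/(generating3P dimL dimq).
  by exists (V 0 0 0 1), (V (- y1) (- y2) (- y3) 0).
exists (V 0 0 0 1), (V x1 x2 x3 0), (V (- y1) (- y2) (- y3) 0); split=> //.
apply: (adapted_basisI dimL dimq) => //; rewrite ?Tx ?xy ?mem0v //.
apply/eqP => /(vec4_eq0 basisA)[x1_0 x2_0 x3_0 _]; case/eqP: nz_fz.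
by rewrite /y1 /y2 /y3 x1_0 x2_0 x3_0 /ad1 /ad2 /ad3; ring.
Qed.

(** The subspace is spanned by [T] and the plane of the ideal where f vanishes; it generates because
    w is in it and the bracket of w with [T] is not. *)
Lemma abelian_invariant_line k1 k2 k3 w1 w2 w3 f1 f2 f3 :
    f1 * k1 + f2 * k2 + f3 * k3 = 0 -> f1 * w1 + f2 * w2 + f3 * w3 = 0 ->
    f1 * ad1 w1 w2 w3 + f2 * ad2 w1 w2 w3 + f3 * ad3 w1 w2 w3 != 0 ->
  exists2 q : {vspace L}, generating3 q & V k1 k2 k3 0 \in q.
Proof.
move=> fk fw nz_fz.
have [|q dimq memq] := @hyperplane_exists _ _ _ _ _ _ basisA f1 f2 f3 0.
  apply: contraNT nz_fz; rewrite !negb_or !negbK => /and4P[/eqP-> /eqP-> /eqP-> _].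
  by rewrite !mul0r !addr0.
exists q; last by rewrite memq mul0r addr0 fk.
apply/(generating3P dimL dimq); exists (V w1 w2 w3 0), (V 0 0 0 1); split.
- by rewrite memq mul0r addr0 fw.
- by rewrite memq; apply/eqP; ring.
- by rewrite lie_abelian memq !mul0r !mul1r !subr0 addr0.
Qed.

(** The eigenvalue of the kernel vector separates the first two cases: 0 gives the center, any other
    value a noncentral ideal. *)
Lemma abelian_exhaustive_center (q : {vspace L}) z1 z2 z3 y1 y2 y3 :
    (forall x1 x2 x3, ad1 x1 x2 x3 = 0 -> ad2 x1 x2 x3 = 0 -> ad3 x1 x2 x3 = 0 ->
       exists c, [/\ x1 = c * z1, x2 = c * z2 & x3 = c * z3]) ->
    [|| ad1 y1 y2 y3 != 0, ad2 y1 y2 y3 != 0 | ad3 y1 y2 y3 != 0] ->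
    generating3 q ->
  [\/ contains_center q, contains_1dim_noncentral_ideal q | exists e1 e2 e3,
    [/\ adapted_basis q e1 e2 e3, e3 = [lie e1, e2] & [lie e2, e3] = 0]].
Proof.
move=> ker_ad nz_ad /abelian_cases[|]; last by constructor 3.
case=> k1 [k2 [k3 [c [qk nz_k [eig1 eig2 eig3]]]]].
have [c0 | nz_c] := eqVneq c 0.
  constructor 1; move: eig1 eig2 eig3; rewrite c0 !mul0r => eig1 eig2 eig3.
  exact: contains_center_eigenvector ker_ad nz_ad eig1 eig2 eig3 qk nz_k.
constructor 2; exact: contains_noncentral_abelian eig1 eig2 eig3 nz_c qk nz_k.
Qed.

(** For an action without nonzero eigenvalue in [F]: nilpotent, or with two nonreal eigenvalues
    besides 0. *)
Lemma abelian_exhaustive_eigen0 (q : {vspace L}) z1 z2 z3 y1 y2 y3 :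
    (forall x1 x2 x3, ad1 x1 x2 x3 = 0 -> ad2 x1 x2 x3 = 0 -> ad3 x1 x2 x3 = 0 ->
       exists c, [/\ x1 = c * z1, x2 = c * z2 & x3 = c * z3]) ->
    [|| ad1 y1 y2 y3 != 0, ad2 y1 y2 y3 != 0 | ad3 y1 y2 y3 != 0] ->
    (forall x1 x2 x3 c, c != 0 -> ad1 x1 x2 x3 = c * x1 ->
       ad2 x1 x2 x3 = c * x2 -> ad3 x1 x2 x3 = c * x3 ->
       [/\ x1 = 0, x2 = 0 & x3 = 0]) ->
    generating3 q ->
  contains_center q \/ exists e1 e2 e3,
    [/\ adapted_basis q e1 e2 e3, e3 = [lie e1, e2] & [lie e2, e3] = 0].
Proof.
move=> ker_ad nz_ad eig0 /abelian_cases[|]; last by right.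
case=> k1 [k2 [k3 [c [qk nz_k [eig1 eig2 eig3]]]]].
have [c0 | nz_c] := eqVneq c 0.
  left; move: eig1 eig2 eig3; rewrite c0 !mul0r => eig1 eig2 eig3.
  exact: contains_center_eigenvector ker_ad nz_ad eig1 eig2 eig3 qk nz_k.
have [k1_0 k2_0 k3_0] := eig0 _ _ _ _ nz_c eig1 eig2 eig3.
by case/eqP: nz_k; rewrite k1_0 k2_0 k3_0 vec4_0.
Qed.

Lemma abelian_exhaustive_centerless (q : {vspace L}) :
    (forall x1 x2 x3, ad1 x1 x2 x3 = 0 -> ad2 x1 x2 x3 = 0 -> ad3 x1 x2 x3 = 0 ->
       [/\ x1 = 0, x2 = 0 & x3 = 0]) ->
    generating3 q ->
  contains_1dim_noncentral_ideal q \/ exists e1 e2 e3,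
    [/\ adapted_basis q e1 e2 e3, e3 = [lie e1, e2] & [lie e2, e3] = 0].
Proof.
move=> ker_ad /abelian_cases[|]; last by right.
case=> k1 [k2 [k3 [c [qk nz_k [eig1 eig2 eig3]]]]].
have [c0 | nz_c] := eqVneq c 0; last first.
  left; exact: contains_noncentral_abelian eig1 eig2 eig3 nz_c qk nz_k.
move: eig1 eig2 eig3; rewrite c0 !mul0r => eig1 eig2 eig3.
have [k1_0 k2_0 k3_0] := ker_ad _ _ _ eig1 eig2 eig3.
by case/eqP: nz_k; rewrite k1_0 k2_0 k3_0 vec4_0.
Qed.

Lemma abelian_exists_center z1 z2 z3 w1 w2 w3 f1 f2 f3 :
    (forall x1 x2 x3, ad1 x1 x2 x3 = 0 -> ad2 x1 x2 x3 = 0 -> ad3 x1 x2 x3 = 0 ->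
       exists c, [/\ x1 = c * z1, x2 = c * z2 & x3 = c * z3]) ->
    f1 * z1 + f2 * z2 + f3 * z3 = 0 -> f1 * w1 + f2 * w2 + f3 * w3 = 0 ->
    f1 * ad1 w1 w2 w3 + f2 * ad2 w1 w2 w3 + f3 * ad3 w1 w2 w3 != 0 ->
  exists2 q : {vspace L}, generating3 q & contains_center q.
Proof.
move=> ker_ad fz fw nz_fw; have [q gen_q qz] := abelian_invariant_line fz fw nz_fw.
exists q => //.
apply: (contains_center_abelian (y1 := w1) (y2 := w2) (y3 := w3) ker_ad _ qz).
  apply: contraNT nz_fw; rewrite !negb_or !negbK => /and3P[/eqP-> /eqP-> /eqP->].
by rewrite !mulr0 !addr0.
Qed.

Lemma abelian_exists_noncentral c k1 k2 k3 w1 w2 w3 f1 f2 f3 :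
    c != 0 -> [|| k1 != 0, k2 != 0 | k3 != 0] ->
    ad1 k1 k2 k3 = c * k1 -> ad2 k1 k2 k3 = c * k2 -> ad3 k1 k2 k3 = c * k3 ->
    f1 * k1 + f2 * k2 + f3 * k3 = 0 -> f1 * w1 + f2 * w2 + f3 * w3 = 0 ->
    f1 * ad1 w1 w2 w3 + f2 * ad2 w1 w2 w3 + f3 * ad3 w1 w2 w3 != 0 ->
  exists2 q : {vspace L}, generating3 q & contains_1dim_noncentral_ideal q.
Proof.
move=> nz_c nz_k eig1 eig2 eig3 fk fw nz_fw.
have [q gen_q qk] := abelian_invariant_line fk fw nz_fw; exists q => //.
apply: contains_noncentral_abelian eig1 eig2 eig3 nz_c qk _.
by apply: contraTneq nz_k => /(vec4_eq0 basisA)[-> -> -> _]; rewrite eqxx.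
Qed.

End AbelianFamily.

(** When [E4] is central and [[E1, E2] = 0], the abelian ideal is spanned by [E1], [E2], [E4]; the
    exchange puts the acting vector [E3] last. *)
Lemma lie_basis_swap (F : fieldType) (L : lieAlgType F) (E1 E2 E3 E4 b23 b31 : L) :
  lie_basis E1 E2 E3 E4 0 b23 b31 0 0 0 ->
  lie_basis E1 E2 E4 E3 0 0 0 (- b31) b23 0.
Proof.
case=> basisE [[b12E b23E b31E] [b14E b24E b34E]]; split.
  rewrite (@perm_basis _ _ _ [:: E1; E2; E3; E4]) //.
  by rewrite !perm_cons; apply/permPl/(perm_rot 1 [:: E3; E4]).
split; split=> //.
- by rewrite lieC b14E oppr0.
- by rewrite lieC b31E.
- by rewrite lieC b34E oppr0.
Qed.

(** * One vector acting on a Heisenberg ideal *)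

Section HeisenbergFamily.
Variables (F : fieldType) (L : lieAlgType F) (E1 E2 E3 E4 : L).
Local Notation V := (vec4 E1 E2 E3 E4).
Variables tr p r s u w2 w3 : F.
Hypothesis table :
  lie_basis E1 E2 E3 E4 0 E1 0 (V tr 0 0 0) (V 0 p r 0) (V 0 s u 0).
Hypothesis trE : tr = p + u.
(** With M the matrix of rows (p, r) and (s, u), this is the determinant of the rows w and w M: w is
    not an eigenvector, and such a w exists unless M is scalar. The equality [tr = p + u] is what
    the Jacobi identity imposes on [E1 = [E2, E3]]. *)
Hypothesis not_eigen : w2 * (r * w2 + u * w3) - w3 * (p * w2 + s * w3) != 0.

Let basisE : basis_of fullv [:: E1; E2; E3; E4] := table.1.
Let dimL : \dim {:L} = 4%N := dim_basis4 basisE.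

Lemma lie_heisenberg x1 x2 x3 x4 y1 y2 y3 y4 :
  [lie V x1 x2 x3 x4, V y1 y2 y3 y4] =
  V (x2 * y3 - x3 * y2 + tr * (x1 * y4 - x4 * y1))
    (p * (x2 * y4 - x4 * y2) + s * (x3 * y4 - x4 * y3))
    (r * (x2 * y4 - x4 * y2) + u * (x3 * y4 - x4 * y3)) 0.
Proof.
case: table => _ [[b12 b23 b31] [b14 b24 b34]].
rewrite lie_vec4 b12 b23 b31 b14 b24 b34 /vec4; module.
Qed.

(* If [E1] is not in [q], then [q] has an equation x1 + b x2 + c x3 + d x4 = 0,
   and [e2] is the element with last coordinate -1 of the kernel of the form
   (x, y) |-> [x, y] mod q. It acts on the intersection of [q] with
   <E1, E2, E3>, modulo [e2], as the matrix with rows (p, r) and (s, u). *)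
Lemma heisenberg_cases (q : {vspace L}) : generating3 q ->
  V 1 0 0 0 \in q \/
  exists e1 e2 e3, [/\ adapted_basis q e1 e2 e3, e3 = [lie e1, e2],
    struct_const e1 e2 e3 2 3 1 = p * u - r * s
    & struct_const e1 e2 e3 2 3 2 = 0].
Proof.
case=> dimq _; have [a [b0 [c0 [d0 memq0]]]] := hyperplane_equation basisE dimq.
have [a0 | nz_a] := eqVneq a 0.
  by left; rewrite memq0 a0; apply/eqP; ring.
right; pose b := b0 / a; pose c := c0 / a; pose d := d0 / a.
have memq x1 x2 x3 x4 :
    (V x1 x2 x3 x4 \in q) = (x1 + b * x2 + c * x3 + d * x4 == 0).
  rewrite memq0 -[RHS](inj_eq (mulfI nz_a)) mulr0; congr (_ == _).
  by rewrite /b /c /d; field.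
have mem0q x1 x2 x3 x4 : x1 + b * x2 + c * x3 + d * x4 = 0 -> V x1 x2 x3 x4 \in q.
  by rewrite memq => ->.
pose v2 := p * c - s * b; pose v3 := r * c - u * b.
(* This lifts w to [q] with last coordinate 0; then [[e1, [e1, e2]]] is, up to sign, [E1] times the
   determinant of [not_eigen]. *)
pose e1 := V (- (b * w2 + c * w3)) w2 w3 0.
pose e2 := V (d - b * v2 - c * v3) v2 v3 (-1).
have qe1 : e1 \in q by apply: mem0q; ring.
have qe2 : e2 \in q by apply: mem0q; ring.
have nz_e2 : e2 != 0.
  by apply/eqP => /(vec4_eq0 basisE)[_ _ _ /eqP]; rewrite oppr_eq0 oner_eq0.
have qe3 : [lie e1, e2] \in q.
  by rewrite lie_heisenberg; apply: mem0q; rewrite /v2 /v3 trE; ring.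
(* Cayley-Hamilton for the matrix of rows (p, r) and (s, u): the determinant goes to [e1], the trace
   to [[e1, e2]], and nothing to [e2]. *)
have e23E : [lie e2, [lie e1, e2]] =
    (p * u - r * s) *: e1 + 0 *: e2 + tr *: [lie e1, e2].
  rewrite !lie_heisenberg !vec4Z !vec4D; congr vec4; rewrite /v2 /v3 trE; ring.
have q23 : [lie e2, [lie e1, e2]] \in q by rewrite e23E !memvD ?memvZ.
have qN13 : [lie e1, [lie e1, e2]] \notin q.
  rewrite !lie_heisenberg memq -oppr_eq0; move: not_eigen; congr (_ != _).
  by rewrite trE; ring.
have [C1 C2] := struct_const23E dimL dimq qe1 qe2 qe3 nz_e2 qe3 q23 qN13 e23E.
exists e1, e2, [lie e1, e2]; split=> //.
exact: adapted_basisI.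
Qed.

Lemma heisenberg_generating_with_E1 :
  exists2 q : {vspace L}, generating3 q & V 1 0 0 0 \in q.
Proof.
have [|q dimq memq] := @hyperplane_exists _ _ _ _ _ _ basisE 0 (- w3) w2 0.
  apply: contraNT not_eigen; rewrite !negb_or !negbK oppr_eq0.
  by move=> /and4P[_ /eqP-> /eqP-> _]; apply/eqP; ring.
exists q; last by rewrite memq; apply/eqP; ring.
apply/(generating3P dimL dimq); exists (V 0 w2 w3 0), (V 0 0 0 1); split.
- by rewrite memq; apply/eqP; ring.
- by rewrite memq; apply/eqP; ring.
- by rewrite lie_heisenberg memq; move: not_eigen; congr (_ != _); ring.
Qed.

Lemma heisenberg_generating_without_E1 :
  exists2 q : {vspace L}, generating3 q & V 1 0 0 0 \notin q.
Proof.
have [|q dimq memq] := @hyperplane_exists _ _ _ _ _ _ basisE 1 0 0 0.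
  by rewrite oner_eq0.
have qN1 : V 1 0 0 0 \notin q by rewrite memq !mul0r !addr0 mul1r oner_eq0.
exists q => //; apply/(generating3P dimL dimq); exists (V 0 1 0 0), (V 0 0 1 0).
split; try by rewrite memq; apply/eqP; ring.
rewrite lie_heisenberg; move: qN1; congr (vec4 _ _ _ _ _ _ _ _ \notin q); ring.
Qed.

Lemma heisenberg_noncentral (q : {vspace L}) : tr != 0 ->
  V 1 0 0 0 \in q -> contains_1dim_noncentral_ideal q.
Proof.
move=> nz_tr qE1; apply: (contains_1dim_noncentral_idealI qE1).
  apply: is_lie_ideal_line => y.
  have [y1 [y2 [y3 [y4 ->]]]] := vec4_surj basisE y; exists (tr * y4).
  by rewrite lie_heisenberg vec4Z; congr vec4; ring.
move/(_ (V 0 0 0 1)); rewrite lie_heisenberg => /(vec4_eq0 basisE)[tr0 _ _ _].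
by case/eqP: nz_tr; rewrite -tr0; ring.
Qed.

(** Central elements lie on the line of [E1]: brackets with [E3] and [E2] remove two coordinates,
    and the bracket with the non-eigenvector w removes the last one. *)
Lemma heisenberg_center (q : {vspace L}) :
  V 1 0 0 0 \in q -> contains_center q.
Proof.
move=> qE1 x; have [x1 [x2 [x3 [x4 ->]]]] := vec4_surj basisE x => cx.
have := cx (V 0 0 1 0); rewrite lie_heisenberg => /(vec4_eq0 basisE)[x2_0 _ _ _].
have {}x2_0 : x2 = 0 by rewrite -x2_0; ring.
have := cx (V 0 1 0 0); rewrite lie_heisenberg => /(vec4_eq0 basisE)[x3_0 _ _ _].
have {}x3_0 : x3 = 0 by apply: oppr_inj; rewrite oppr0 -x3_0; ring.
have := cx (V 0 w2 w3 0); rewrite lie_heisenberg => /(vec4_eq0 basisE)[_ eq2 eq3 _].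
have x4_0 : x4 = 0.
  apply: (mulIf not_eigen); rewrite mul0r.
  move: (congr2 (fun y z => w3 * y - w2 * z) eq2 eq3) => /=.
  by rewrite !mulr0 subr0 => <-; ring.
rewrite x2_0 x3_0 x4_0; have -> : V x1 0 0 0 = x1 *: V 1 0 0 0.
  by rewrite vec4Z !mulr0 mulr1.
exact: memvZ.
Qed.

(** Keeping [P] and [C] abstract lets one argument serve every algebra: the choice of [P] depends on
    the trace, and [C] is tested at the determinant, which will be 1, alpha or alpha^2 + 1. *)
Lemma heisenberg_possible_cases (P : {vspace L} -> Prop) (C : F -> Prop) :
    (forall q : {vspace L}, V 1 0 0 0 \in q -> P q) -> C (p * u - r * s) ->
  possible_cases2 P (fun q => exists e1 e2 e3,
    [/\ adapted_basis q e1 e2 e3, e3 = [lie e1, e2],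
       C (struct_const e1 e2 e3 2 3 1) & struct_const e1 e2 e3 2 3 2 = 0]).
Proof.
move=> PE1 Cdet; have condC (q : {vspace L}) : (exists e1 e2 e3,
      [/\ adapted_basis q e1 e2 e3, e3 = [lie e1, e2],
       struct_const e1 e2 e3 2 3 1 = p * u - r * s
       & struct_const e1 e2 e3 2 3 2 = 0]) ->
    exists e1 e2 e3, [/\ adapted_basis q e1 e2 e3, e3 = [lie e1, e2],
       C (struct_const e1 e2 e3 2 3 1) & struct_const e1 e2 e3 2 3 2 = 0].
  by case=> e1 [e2 [e3 [? ? C1 ?]]]; exists e1, e2, e3; rewrite C1.
split.
- by move=> q /heisenberg_cases[/PE1|/condC]; [left|right].
- by have [q gen_q /PE1] := heisenberg_generating_with_E1; exists q.
- have [q gen_q qNE1] := heisenberg_generating_without_E1; exists q => //.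
  by case: (heisenberg_cases gen_q) => [|/condC //]; rewrite (negPf qNE1).
Qed.

End HeisenbergFamily.

(** * A simple ideal plus a central line: so(3) for [sg = 1], sl(2) for [sg = -1] *)

Section SimpleFamily.
Variables (R : realFieldType) (L : lieAlgType R) (E1 E2 E3 E4 : L).
Local Notation V := (vec4 E1 E2 E3 E4).
Variable sg : R.
Hypothesis table : lie_basis E1 E2 E3 E4 (V 0 0 sg 0) E1 E2 0 0 0.
Hypothesis sg2 : sg * sg = 1.

Let basisE : basis_of fullv [:: E1; E2; E3; E4] := table.1.
Let dimL : \dim {:L} = 4%N := dim_basis4 basisE.

Let nz_sg : sg != 0.
Proof. by apply: contra_eqN sg2 => /eqP->; rewrite mul0r eq_sym oner_eq0. Qed.

Lemma lie_simple x1 x2 x3 x4 y1 y2 y3 y4 :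
  [lie V x1 x2 x3 x4, V y1 y2 y3 y4] =
  V (x2 * y3 - x3 * y2) (x3 * y1 - x1 * y3) (sg * (x1 * y2 - x2 * y1)) 0.
Proof.
case: table => _ [[b12 b23 b31] [b14 b24 b34]].
rewrite lie_vec4 b12 b23 b31 b14 b24 b34 /vec4; module.
Qed.

Section Equation.
Variables (q : {vspace L}) (a b c d : R).
Hypothesis dimq : \dim q = 3%N.
Hypothesis memq : forall x1 x2 x3 x4,
  (V x1 x2 x3 x4 \in q) = (a * x1 + b * x2 + c * x3 + d * x4 == 0).
Hypothesis nz_d : d != 0.

Let mem0q x1 x2 x3 x4 : a * x1 + b * x2 + c * x3 + d * x4 = 0 -> V x1 x2 x3 x4 \in q.
Proof. by rewrite memq => ->. Qed.

(** For [a = b = c = 0] the hyperplane is spanned by [E1], [E2], [E3] and contains all brackets. *)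
Lemma simple_generating_neq0 : generating3 q -> [|| a != 0, b != 0 | c != 0].
Proof.
case/(generating3P dimL dimq)=> x [y [_ _]].
have [x1 [x2 [x3 [x4 ->]]]] := vec4_surj basisE x.
have [y1 [y2 [y3 [y4 ->]]]] := vec4_surj basisE y.
apply: contraNT; rewrite !negb_or !negbK => /and3P[/eqP a0 /eqP b0 /eqP c0].
by rewrite lie_simple; apply: mem0q; rewrite a0 b0 c0; ring.
Qed.

(** The bracket of x and y lies in [q] iff the first three coordinates of x and y and the vector (a,
    b, sg c) have determinant 0, so the kernel vector projects to (a, b, sg c). There the invariant
    form x1^2 + x2^2 + sg x3^2 takes the value N. A vector [e1] of [q] with last coordinate 0 is
    orthogonal to this projection, and then [[e2, [e1, e2]]] is sg N [e1]. *)
Lemma simple_nonnull :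
    [|| a != 0, b != 0 | c != 0] -> a * a + b * b + sg * (c * c) != 0 ->
  exists e1 e2 e3, [/\ adapted_basis q e1 e2 e3,
    e3 = [lie e1, e2], [lie e2, e3] <> 0 & collinear [lie e2, e3] e1].
Proof.
move=> nz_abc nz_N; set N := _ + _ in nz_N.
pose e2 := V a b (sg * c) (- N / d).
have qe2 : e2 \in q by apply: mem0q; rewrite /N; field.
suff [e1 [t [qe1 q12 qN13 nz_t e23]]] : exists e1 t,
    [/\ e1 \in q, [lie e1, e2] \in q, [lie e1, [lie e1, e2]] \notin q,
       t != 0 & [lie e2, [lie e1, e2]] = t *: e1].
  have nz_e1 : e1 != 0 by apply: contraNneq qN13 => ->; rewrite lie0l mem0v.
  have nz_e2 : e2 != 0 by apply: contraNneq qN13 => ->; rewrite !lie0r mem0v.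
  exists e1, e2, [lie e1, e2]; split=> //.
  - by apply: (adapted_basisI dimL dimq) => //; rewrite e23 memvZ.
  - by rewrite e23; apply/eqP; rewrite scaler_eq0 negb_or nz_t.
  - by exists e1, t, 1; rewrite scale1r.
(* The choice (b, -a, 0, 0) for [e1] fails only for [a = b = 0], where [E1] replaces it and sg N is
   [c * c]. *)
have [ab0 | nz_ab] := eqVneq (a * a + b * b) 0.
  move/eqP: ab0; rewrite paddr_eq0 ?sqr_ge0 -?expr2 ?sqr_ge0 // !sqrf_eq0.
  move=> /andP[/eqP a0 /eqP b0].
  have nz_c : c != 0 by move: nz_abc; rewrite a0 b0 eqxx.
  exists (V 1 0 0 0), (c * c); split.
  - by apply: mem0q; rewrite a0; ring.
  - by rewrite lie_simple; apply: mem0q; rewrite a0 b0; ring.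
  - rewrite !lie_simple memq.
    move: (mulf_neq0 nz_c nz_c); rewrite -oppr_eq0; congr (_ != _).
    by rewrite a0 b0 [sg * _]mulrC; ring: sg2.
  - exact: mulf_neq0.
  - rewrite !lie_simple vec4Z; congr vec4; ring: sg2 a0 b0.
exists (V b (- a) 0 0), (sg * N); split.
- by apply: mem0q; ring.
- by rewrite lie_simple; apply: mem0q; rewrite /N; ring: sg2.
- rewrite !lie_simple memq.
  move: (mulf_neq0 (mulf_neq0 nz_sg nz_ab) nz_N); rewrite -oppr_eq0.
  by congr (_ != _); rewrite /N; ring: sg2.
- exact: mulf_neq0.
- by rewrite !lie_simple vec4Z; congr vec4; rewrite /N; ring: sg2.
Qed.

(** Now [e2] projects to a null vector of the indefinite form, and [e1] to a second one, (a, b, c),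
    with the last coordinate that puts it into [q]. Up to scaling, the projections of [e1],
    [[e1, e2]], [e2] form a standard triple of sl(2), which makes [e2] an eigenvector of
    [[e1, e2]]. *)
Lemma simple_null :
    [|| a != 0, b != 0 | c != 0] -> sg = -1 -> a * a + b * b = c * c ->
  exists e1 e2 e3, [/\ adapted_basis q e1 e2 e3,
    e3 = [lie e1, e2], [lie e2, e3] <> 0 & collinear [lie e2, e3] e2].
Proof.
move=> nz_abc sgE null; have null' : a * a = c * c - b * b by rewrite -null addrK.
have nz_c : c != 0.
  apply: contraTneq nz_abc => c0; move/eqP: null; rewrite c0 mulr0.
  rewrite paddr_eq0 -?expr2 ?sqr_ge0 // !sqrf_eq0 => /andP[/eqP-> /eqP->].
  by rewrite eqxx.
pose e1 := V a b c (- (2 * (c * c)) / d); pose e2 := V a b (- c) 0.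
have qe1 : e1 \in q 
  by apply: mem0q; rewrite -[RHS](subrr (c * c)) -[X in _ = X - _]null; field.
have qe2 : e2 \in q by apply: mem0q; ring: null'.
have q12 : [lie e1, e2] \in q by rewrite lie_simple; apply: mem0q; ring.
have e23 : [lie e2, [lie e1, e2]] = (2 * (c * c)) *: e2.
  by rewrite !lie_simple vec4Z sgE; congr vec4; ring: null'.
have qN13 : [lie e1, [lie e1, e2]] \notin q.
  rewrite !lie_simple memq sgE.
  have : 4%:R * (c * c) * (c * c) != 0 by rewrite !mulf_neq0 ?pnatr_eq0.
  by rewrite -oppr_eq0; congr (_ != _); ring: null'.
have nz_e2 : e2 != 0 by apply: contraNneq qN13 => ->; rewrite !lie0r mem0v.
exists e1, e2, [lie e1, e2]; split=> //.
- by apply: (adapted_basisI dimL dimq) => //; rewrite e23 memvZ.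
- by rewrite e23; apply/eqP; rewrite scaler_eq0 negb_or nz_e2 !mulf_neq0 ?pnatr_eq0.
- by exists e2, (2 * (c * c)), 1; rewrite scale1r.
Qed.

End Equation.

Lemma simple_generating_E4 :
  exists2 q : {vspace L}, generating3 q & V 0 0 0 1 \in q.
Proof.
have [|q dimq memq] := @hyperplane_exists _ _ _ _ _ _ basisE 1 0 0 0.
  by rewrite oner_eq0.
exists q; last by rewrite memq; apply/eqP; ring.
apply/(generating3P dimL dimq); exists (V 0 1 0 0), (V 0 0 1 0).
split; try by rewrite memq; apply/eqP; ring.
by rewrite lie_simple memq !(mul0r, mul1r, mulr0, subr0, addr0, add0r) oner_eq0.
Qed.

(** The invariant form takes the value 1 + sg c^2 here: [c = 1] is the null case for [sg = -1], and
    [c = 0] is never null. *)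
Lemma simple_generating_graph c :
  exists q : {vspace L}, [/\ generating3 q, \dim q = 3%N &
    forall x1 x2 x3 x4,
      (V x1 x2 x3 x4 \in q) = (1 * x1 + 0 * x2 + c * x3 + 1 * x4 == 0)].
Proof.
have [|q dimq memq] := @hyperplane_exists _ _ _ _ _ _ basisE 1 0 c 1.
  by rewrite oner_eq0.
exists q; split=> //; apply/(generating3P dimL dimq).
exists (V 0 1 0 0), (V 0 0 1 (- c)).
split; try by rewrite memq; apply/eqP; ring.
by rewrite lie_simple memq !(mul0r, mul1r, mulr0, subr0, addr0, add0r) oner_eq0.
Qed.

Lemma simple_center (q : {vspace L}) : V 0 0 0 1 \in q -> contains_center q.
Proof.
move=> qE4 x; have [x1 [x2 [x3 [x4 ->]]]] := vec4_surj basisE x => cx.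
have := cx (V 1 0 0 0); rewrite lie_simple => /(vec4_eq0 basisE)[_ x3_0 x2_0 _].
have := cx (V 0 0 1 0); rewrite lie_simple => /(vec4_eq0 basisE)[_ x1_0 _ _].
have {}x1_0 : x1 = 0 by apply: oppr_inj; rewrite oppr0 -x1_0; ring.
have {}x3_0 : x3 = 0 by rewrite -x3_0; ring.
have {}x2_0 : x2 = 0.
  by apply: oppr_inj; apply: (mulfI nz_sg); rewrite oppr0 mulr0 -x2_0; ring.
rewrite x1_0 x2_0 x3_0; have -> : V 0 0 0 x4 = x4 *: V 0 0 0 1.
  by rewrite vec4Z !mulr0 mulr1.
exact: memvZ.
Qed.

End SimpleFamily.

(** * The sum of two nonabelian planes *)

Section Algebra2g21.
Variables (R : realFieldType) (L : lieAlgType R) (E1 E2 E3 E4 : L).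
Local Notation V := (vec4 E1 E2 E3 E4).
Hypothesis table : is_2g21 E1 E2 E3 E4.

Let basisE : basis_of fullv [:: E1; E2; E3; E4] := table.1.
Let dimL : \dim {:L} = 4%N := dim_basis4 basisE.

Lemma lie_2g21 x1 x2 x3 x4 y1 y2 y3 y4 :
  [lie V x1 x2 x3 x4, V y1 y2 y3 y4] =
  V (x1 * y2 - x2 * y1) 0 (x3 * y4 - x4 * y3) 0.
Proof.
case: table => _ [[b12 b23 b31] [b14 b24 b34]].
rewrite lie_vec4 b12 b23 b31 b14 b24 b34 /vec4; module.
Qed.

Lemma ideal_2g21 (q : {vspace L}) :
  V 1 0 0 0 \in q \/ V 0 0 1 0 \in q -> contains_1dim_ideal q.
Proof.
suff idealI k : k != 0 -> (forall y, exists c, [lie k, y] = c *: k) ->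
    k \in q -> contains_1dim_ideal q.
  case; apply: idealI; try by apply/eqP => /(vec4_eq0 basisE)[] /eqP;
    rewrite ?oner_eq0 // => _ _ /eqP; rewrite oner_eq0.
  - move=> y; have [y1 [y2 [y3 [y4 ->]]]] := vec4_surj basisE y; exists y2.
    by rewrite lie_2g21 vec4Z; congr vec4; ring.
  - move=> y; have [y1 [y2 [y3 [y4 ->]]]] := vec4_surj basisE y; exists y4.
    by rewrite lie_2g21 vec4Z; congr vec4; ring.
move=> nz_k ideal_k qk; exists <[k]>%VS; split=> //.
  exact: is_lie_ideal_line.
by rewrite dim_vline nz_k.
Qed.

(** The coordinates -1 of [e2] along [E2] and [E4] make it act as the identity on the derived
    algebra, spanned by [E1] and [E3], whose intersection with [q] is the line of [e3]. The vector
    [e1] is the component of [e2] in the first summand, hence commutes with it. *)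
Lemma cases_2g21 (q : {vspace L}) a b c d : \dim q = 3%N ->
    (forall x1 x2 x3 x4,
      (V x1 x2 x3 x4 \in q) = (a * x1 + b * x2 + c * x3 + d * x4 == 0)) ->
    a != 0 -> c != 0 ->
  exists e1 e2 e3, [/\ adapted_basis q e1 e2 e3,
    [lie e1, e2] = 0, [lie e2, e3] <> 0 & collinear [lie e2, e3] e3].
Proof.
move=> dimq memq nz_a nz_c.
pose e1 := V (b / a) (-1) 0 0; pose e2 := V (b / a) (-1) (d / c) (-1).
pose e3 := V c 0 (- a) 0.
have e12 : [lie e1, e2] = 0.
  by rewrite lie_2g21 -[RHS](vec4_0 E1 E2 E3 E4); congr vec4; ring.
have e23 : [lie e2, e3] = e3 by rewrite lie_2g21; congr vec4; ring.
have qe1 : e1 \in q by rewrite memq; apply/eqP; field.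
have qe2 : e2 \in q by rewrite memq; apply/eqP; field; apply/andP.
have qe3 : e3 \in q by rewrite memq; apply/eqP; ring.
have qN13 : [lie e1, e3] \notin q.
  rewrite lie_2g21 memq; move: (mulf_neq0 nz_a nz_c); congr (_ != _); ring.
have nz_e2 : e2 != 0.
  by apply/eqP => /(vec4_eq0 basisE)[_ _ _ /eqP]; rewrite oppr_eq0 oner_eq0.
exists e1, e2, e3; split=> //.
- by apply: (adapted_basisI dimL dimq); rewrite ?e12 ?e23 ?mem0v.
- by rewrite e23 => e3_0; move: qN13; rewrite e3_0 lie0r mem0v.
- by exists e3, 1, 1; rewrite scale1r.
Qed.

Lemma possible_cases_2g21 : possible_cases2 (L := L)
     (fun q => contains_1dim_ideal q)
     (fun q => exists e1 e2 e3, [/\ adapted_basis q e1 e2 e3,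
        [lie e1, e2] = 0, [lie e2, e3] <> 0 & collinear [lie e2, e3] e3]).
Proof.
split.
- move=> q [dimq _]; have [a [b [c [d memq]]]] := hyperplane_equation basisE dimq.
  have [a0 | nz_a] := eqVneq a 0.
    by left; apply: ideal_2g21; left; rewrite memq a0; apply/eqP; ring.
  have [c0 | nz_c] := eqVneq c 0.
    by left; apply: ideal_2g21; right; rewrite memq c0; apply/eqP; ring.
  by right; apply: cases_2g21 memq nz_a nz_c.
- have [|q dimq memq] := @hyperplane_exists _ _ _ _ _ _ basisE 0 1 1 0.
    by rewrite oner_eq0 orbT.
  exists q; last by apply: ideal_2g21; left; rewrite memq; apply/eqP; ring.
  apply/(generating3P dimL dimq); exists (V 0 (-1) 1 0), (V 0 0 0 1).
  split; try by rewrite memq; apply/eqP; ring.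
  by rewrite lie_2g21 memq !(mul0r, mul1r, mulr0, mulr1, subr0, add0r, addr0) oner_eq0.
- have [|q dimq memq] := @hyperplane_exists _ _ _ _ _ _ basisE 1 0 1 0.
    by rewrite oner_eq0.
  exists q; last by apply: cases_2g21 memq _ _; rewrite ?oner_eq0.
  apply/(generating3P dimL dimq); exists (V 1 0 (-1) 0), (V 0 1 0 0).
  split; try by rewrite memq; apply/eqP; ring.
  by rewrite lie_2g21 memq !(mul0r, mul1r, mulr0, mulr1, subr0, add0r, addr0) oner_eq0.
Qed.

End Algebra2g21.

Lemma neq0_eq (F : fieldType) (x y : F) : x = y -> y != 0 -> x != 0.
Proof. by move->. Qed.

Ltac to_vec4 h := move: h; congr (lie_basis _ _ _ _ _ _ _ _ _ _);
  rewrite /vec4; module.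

Ltac nonzero := by rewrite ?(oppr_eq0, oner_eq0, orbT).

Ltac nonzero_eq y :=
  apply: (neq0_eq (y := y)); [ring | rewrite ?(oppr_eq0, oner_eq0) //].

(** * The individual algebras with an abelian ideal *)

Section AbelianItems.
Variables (R : realType) (L : lieAlgType R) (E1 E2 E3 E4 : L).

Local Notation nil_basis_case := (fun q : {vspace L} => exists e1 e2 e3,
  [/\ adapted_basis q e1 e2 e3, e3 = [lie e1, e2] & [lie e2, e3] = 0]).

Local Notation cases_with_center := (possible_cases3 (L := L)
  (fun q => contains_center q)
  (fun q => contains_1dim_noncentral_ideal q) nil_basis_case).

Local Notation cases_central := (possible_cases2 (L := L)
  (fun q => contains_center q) nil_basis_case).

Local Notation cases_centerless := (possible_cases2 (L := L)
  (fun q => contains_1dim_noncentral_ideal q) nil_basis_case).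

Lemma cases_g32_g1 : is_g32_g1 E1 E2 E3 E4 -> cases_with_center.
Proof.
move/lie_basis_swap => h.
have {h} table : lie_basis E1 E2 E4 E3 0 0 0 (vec4 E1 E2 E4 E3 (-1) 0 0 0)
    (vec4 E1 E2 E4 E3 1 (-1) 0 0) (vec4 E1 E2 E4 E3 0 0 0 0).
  by to_vec4 h.
have ker_ad x1 x2 x3 : x1 * -1 + x2 * 1 + x3 * 0 = 0 ->
    x1 * 0 + x2 * -1 + x3 * 0 = 0 -> x1 * 0 + x2 * 0 + x3 * 0 = 0 ->
    exists c : R, [/\ x1 = c * 0, x2 = c * 0 & x3 = c * 1].
  by exists x3; split; lra.
split.
- move=> q.
  apply: (abelian_exhaustive_center table (y1 := 1) (y2 := 0) (y3 := 0) ker_ad).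
  by apply/or3P; constructor 1; nonzero_eq (-1 : R).
- apply: (abelian_exists_center table (w1 := 0) (w2 := 1) (w3 := 0)
    (f1 := 1) (f2 := 0) (f3 := 0) ker_ad); try ring.
  by nonzero_eq (1 : R).
- apply: (abelian_exists_noncentral table (c := -1) (k1 := 1) (k2 := 0) (k3 := 0)
    (w1 := 0) (w2 := 1) (w3 := 1) (f1 := 0) (f2 := 1) (f3 := -1));
    try ring; try nonzero.
  by nonzero_eq (-1 : R).
- apply: (abelian_cyclic table (x1 := 0) (x2 := 1) (x3 := 1)
    (f1 := 1) (f2 := 1) (f3 := -1)); try ring.
  by nonzero_eq (-1 : R).
Qed.

Lemma cases_g34_g1 (alpha : R) : 0 <= alpha -> alpha <> 1 ->
  is_g34_g1 alpha E1 E2 E3 E4 -> cases_with_center.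
Proof.
move=> ge0_alpha /eqP neq1_alpha /lie_basis_swap h.
have {h} table : lie_basis E1 E2 E4 E3 0 0 0
    (vec4 E1 E2 E4 E3 (- alpha) 1 0 0)
    (vec4 E1 E2 E4 E3 1 (- alpha) 0 0) (vec4 E1 E2 E4 E3 0 0 0 0).
  by to_vec4 h.
have nz_B : 1 - alpha != 0 by rewrite subr_eq0 eq_sym.
have nz_D : - (1 + alpha) != 0 by rewrite oppr_eq0 gt_eqF //; lra.
have nz_det : 1 - alpha * alpha != 0.
  by nonzero_eq (- ((1 - alpha) * - (1 + alpha))); rewrite mulf_neq0.
have ker_ad x1 x2 x3 : x1 * - alpha + x2 * 1 + x3 * 0 = 0 ->
    x1 * 1 + x2 * - alpha + x3 * 0 = 0 -> x1 * 0 + x2 * 0 + x3 * 0 = 0 ->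
    exists c : R, [/\ x1 = c * 0, x2 = c * 0 & x3 = c * 1].
  move=> eq1 eq2 _; have x2E : x2 = x1 * alpha by lra.
  have x1_0 : x1 = 0.
    by apply: (mulIf nz_det); rewrite mul0r -[RHS]eq2 x2E; ring.
  by exists x3; rewrite x2E x1_0; split; ring.
split.
- move=> q.
  apply: (abelian_exhaustive_center table (y1 := 1) (y2 := 0) (y3 := 0) ker_ad).
  by apply/or3P; constructor 2; nonzero_eq (1 : R).
- apply: (abelian_exists_center table (w1 := 1) (w2 := 0) (w3 := 0)
    (f1 := 0) (f2 := 1) (f3 := 0) ker_ad); try ring.
  by nonzero_eq (1 : R).
(* The eigenvalue of (1, -1, 0) is nonzero because alpha is nonnegative. *)
- apply: (abelian_exists_noncentral table (c := - (1 + alpha))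
    (k1 := 1) (k2 := -1) (k3 := 0)
    (w1 := 1) (w2 := 0) (w3 := 1) (f1 := 1) (f2 := 1) (f3 := -1));
    try ring; try nonzero; first exact: nz_D.
  by nonzero_eq (1 - alpha).
- apply: (abelian_cyclic table (x1 := 1) (x2 := 0) (x3 := 1)
    (f1 := 1) (f2 := alpha) (f3 := -1)); try ring.
  by nonzero_eq (1 - alpha * alpha).
Qed.

Lemma cases_g43 : is_g43 E1 E2 E3 E4 -> cases_with_center.
Proof.
move=> h.
have {h} table : lie_basis E1 E2 E3 E4 0 0 0
    (vec4 E1 E2 E3 E4 1 0 0 0)
    (vec4 E1 E2 E3 E4 0 0 0 0) (vec4 E1 E2 E3 E4 0 1 0 0).
  by to_vec4 h.
have ker_ad x1 x2 x3 : x1 * 1 + x2 * 0 + x3 * 0 = 0 ->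
    x1 * 0 + x2 * 0 + x3 * 1 = 0 -> x1 * 0 + x2 * 0 + x3 * 0 = 0 ->
    exists c : R, [/\ x1 = c * 0, x2 = c * 1 & x3 = c * 0].
  by exists x2; split; lra.
split.
- move=> q.
  apply: (abelian_exhaustive_center table (y1 := 1) (y2 := 0) (y3 := 0) ker_ad).
  by apply/or3P; constructor 1; nonzero_eq (1 : R).
- apply: (abelian_exists_center table (w1 := 1) (w2 := 0) (w3 := 1)
    (f1 := 1) (f2 := 0) (f3 := -1) ker_ad); try ring.
  by nonzero_eq (1 : R).
- apply: (abelian_exists_noncentral table (c := 1) (k1 := 1) (k2 := 0) (k3 := 0)
    (w1 := 0) (w2 := 0) (w3 := 1) (f1 := 0) (f2 := 1) (f3 := 0));
    try ring; try nonzero.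
  by nonzero_eq (1 : R).
- apply: (abelian_cyclic table (x1 := 1) (x2 := 0) (x3 := 1)
    (f1 := 1) (f2 := -1) (f3 := -1)); try ring.
  by nonzero_eq (1 : R).
Qed.

Lemma cases_g35_g1 (alpha : R) : is_g35_g1 alpha E1 E2 E3 E4 -> cases_central.
Proof.
move=> /lie_basis_swap h.
have {h} table : lie_basis E1 E2 E4 E3 0 0 0
    (vec4 E1 E2 E4 E3 (- alpha) (-1) 0 0)
    (vec4 E1 E2 E4 E3 1 (- alpha) 0 0) (vec4 E1 E2 E4 E3 0 0 0 0).
  by to_vec4 h.
have nz_det (b : R) : 1 + b * b != 0.
  by rewrite gt_eqF // ltr_pwDl // -expr2 sqr_ge0.
(* The characteristic polynomial of this block, (c + alpha)^2 + 1, has no real root; [c = 0] gives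
   the center, other values exclude noncentral ideals. *)
have no_eigen (x1 x2 c : R) : x1 * - alpha + x2 * 1 = c * x1 ->
    x1 * -1 + x2 * - alpha = c * x2 -> x1 = 0 /\ x2 = 0.
  move=> eq1 eq2; have x2E : x2 = (c + alpha) * x1 by lra.
  suff x1_0 : x1 = 0 by rewrite x2E x1_0 mulr0.
  apply: (mulIf (nz_det (c + alpha))); rewrite mul0r.
  by move: eq2; rewrite x2E => /eqP; rewrite -subr_eq0 -oppr_eq0 => /eqP <-; ring.
have ker_ad x1 x2 x3 : x1 * - alpha + x2 * 1 + x3 * 0 = 0 ->
    x1 * -1 + x2 * - alpha + x3 * 0 = 0 -> x1 * 0 + x2 * 0 + x3 * 0 = 0 ->
    exists c : R, [/\ x1 = c * 0, x2 = c * 0 & x3 = c * 1].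
  move=> eq1 eq2 _; have [||-> ->] := no_eigen x1 x2 0; try lra.
  by exists x3; split; ring.
split.
- move=> q.
  apply: (abelian_exhaustive_eigen0 table (y1 := 1) (y2 := 0) (y3 := 0) ker_ad).
    by apply/or3P; constructor 2; nonzero_eq (-1 : R).
  move=> x1 x2 x3 c nz_c eq1 eq2 eq3.
  have [||-> ->] := no_eigen x1 x2 c; try lra.
  by split=> //; apply: (mulfI nz_c); rewrite -eq3; ring.
- apply: (abelian_exists_center table (w1 := 1) (w2 := 0) (w3 := 0)
    (f1 := 0) (f2 := 1) (f3 := 0) ker_ad); try ring.
  by nonzero_eq (-1 : R).
- apply: (abelian_cyclic table (x1 := 1) (x2 := 0) (x3 := 1)
    (f1 := 1) (f2 := - alpha) (f3 := -1)); try ring.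
  by nonzero_eq (- (1 + alpha * alpha)).
Qed.

Lemma cases_g41 : is_g41 E1 E2 E3 E4 -> cases_central.
Proof.
move=> h.
have {h} table : lie_basis E1 E2 E3 E4 0 0 0
    (vec4 E1 E2 E3 E4 0 0 0 0)
    (vec4 E1 E2 E3 E4 1 0 0 0) (vec4 E1 E2 E3 E4 0 1 0 0).
  by to_vec4 h.
have ker_ad x1 x2 x3 : x1 * 0 + x2 * 1 + x3 * 0 = 0 ->
    x1 * 0 + x2 * 0 + x3 * 1 = 0 -> x1 * 0 + x2 * 0 + x3 * 0 = 0 ->
    exists c : R, [/\ x1 = c * 1, x2 = c * 0 & x3 = c * 0].
  by exists x1; split; lra.
split.
- move=> q.
  apply: (abelian_exhaustive_eigen0 table (y1 := 0) (y2 := 1) (y3 := 0) ker_ad).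
    by apply/or3P; constructor 1; nonzero_eq (1 : R).
  move=> x1 x2 x3 c nz_c eq1 eq2 eq3.
  have x3_0 : x3 = 0 by apply: (mulfI nz_c); rewrite -eq3; ring.
  have x2_0 : x2 = 0 by apply: (mulfI nz_c); rewrite -eq2 x3_0; ring.
  by split=> //; apply: (mulfI nz_c); rewrite -eq1 x2_0; ring.
- apply: (abelian_exists_center table (w1 := 0) (w2 := 0) (w3 := 1)
    (f1 := 0) (f2 := 1) (f3 := 0) ker_ad); try ring.
  by nonzero_eq (1 : R).
- apply: (abelian_cyclic table (x1 := 0) (x2 := 0) (x3 := 1)
    (f1 := 1) (f2 := 0) (f3 := 0)); try ring.
  by nonzero_eq (1 : R).
Qed.

Lemma cases_g42 (alpha : R) : alpha <> 0 -> alpha <> 1 ->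
  is_g42 alpha E1 E2 E3 E4 -> cases_centerless.
Proof.
move=> /eqP nz_alpha /eqP neq1_alpha h.
have {h} table : lie_basis E1 E2 E3 E4 0 0 0
    (vec4 E1 E2 E3 E4 alpha 0 0 0)
    (vec4 E1 E2 E3 E4 0 1 0 0) (vec4 E1 E2 E3 E4 0 1 1 0).
  by to_vec4 h.
split.
- move=> q.
  apply: (abelian_exhaustive_centerless table) => x1 x2 x3 eq1 eq2 eq3.
  split; [|lra|lra].
  by apply: (mulIf nz_alpha); rewrite mul0r -[RHS]eq1; ring.
- apply: (abelian_exists_noncentral table (c := alpha) (k1 := 1) (k2 := 0) (k3 := 0)
    (w1 := 0) (w2 := 0) (w3 := 1) (f1 := 0) (f2 := 1) (f3 := 0));
    try ring; try nonzero.
  by nonzero_eq (1 : R).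
- apply: (abelian_cyclic table (x1 := 1) (x2 := 0) (x3 := 1)
    (f1 := 1) (f2 := 1 - alpha) (f3 := -1)); try ring.
  (* For alpha = 1 the eigenvalue 1 would have two independent eigenvectors, and no cyclic vector
     would exist. *)
  nonzero_eq ((alpha - 1) * (alpha - 1)).
  by rewrite mulf_neq0 // subr_eq0.
Qed.

Lemma cases_g44 : is_g44 E1 E2 E3 E4 -> cases_centerless.
Proof.
move=> h.
have {h} table : lie_basis E1 E2 E3 E4 0 0 0
    (vec4 E1 E2 E3 E4 1 0 0 0)
    (vec4 E1 E2 E3 E4 1 1 0 0) (vec4 E1 E2 E3 E4 0 1 1 0).
  by to_vec4 h.
split.
- move=> q.
  apply: (abelian_exhaustive_centerless table) => x1 x2 x3 eq1 eq2 eq3.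
  by split; lra.
- apply: (abelian_exists_noncentral table (c := 1) (k1 := 1) (k2 := 0) (k3 := 0)
    (w1 := 0) (w2 := 0) (w3 := 1) (f1 := 0) (f2 := 1) (f3 := 0));
    try ring; try nonzero.
  by nonzero_eq (1 : R).
- apply: (abelian_cyclic table (x1 := 0) (x2 := 0) (x3 := 1)
    (f1 := 1) (f2 := 0) (f3 := 0)); try ring.
  by nonzero_eq (1 : R).
Qed.

(** Both parameter ranges enter through these inequalities alone: the diagonal action is invertible,
    and its eigenvalues 1, beta, alpha are distinct, so (1, 1, 1) is cyclic. *)
Lemma cases_g45 (alpha beta : R) :
    alpha != 0 -> beta != 0 -> alpha != beta -> alpha != 1 -> beta != 1 ->
  is_g45 alpha beta E1 E2 E3 E4 -> cases_centerless.
Proof.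
move=> nz_alpha nz_beta neq_ab neq1_alpha neq1_beta h.
have {h} table : lie_basis E1 E2 E3 E4 0 0 0
    (vec4 E1 E2 E3 E4 1 0 0 0)
    (vec4 E1 E2 E3 E4 0 beta 0 0) (vec4 E1 E2 E3 E4 0 0 alpha 0).
  by to_vec4 h.
split.
- move=> q.
  apply: (abelian_exhaustive_centerless table) => x1 x2 x3 eq1 eq2 eq3.
  split; first lra.
  + by apply: (mulIf nz_beta); rewrite mul0r -[RHS]eq2; ring.
  + by apply: (mulIf nz_alpha); rewrite mul0r -[RHS]eq3; ring.
- apply: (abelian_exists_noncentral table (c := 1) (k1 := 1) (k2 := 0) (k3 := 0)
    (w1 := 0) (w2 := 1) (w3 := 1) (f1 := 0) (f2 := -1) (f3 := 1));
    try ring; try nonzero.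
  by nonzero_eq (alpha - beta); rewrite subr_eq0.
- apply: (abelian_cyclic table (x1 := 1) (x2 := 1) (x3 := 1)
    (f1 := alpha - beta) (f2 := 1 - alpha) (f3 := beta - 1)); try ring.
  (* The Vandermonde determinant of 1, beta, alpha, up to sign. *)
  nonzero_eq ((alpha - beta) * ((alpha - 1) * (beta - 1))).
  by rewrite !mulf_neq0 // subr_eq0.
Qed.

Lemma cases_g46 (alpha beta : R) : alpha != 0 ->
  is_g46 alpha beta E1 E2 E3 E4 -> cases_centerless.
Proof.
move=> nz_alpha h.
have {h} table : lie_basis E1 E2 E3 E4 0 0 0
    (vec4 E1 E2 E3 E4 alpha 0 0 0)
    (vec4 E1 E2 E3 E4 0 beta (-1) 0) (vec4 E1 E2 E3 E4 0 1 beta 0).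
  by to_vec4 h.
have nz_det (b : R) : 1 + b * b != 0.
  by rewrite gt_eqF // ltr_pwDl // -expr2 sqr_ge0.
split.
- move=> q.
  apply: (abelian_exhaustive_centerless table) => x1 x2 x3 eq1 eq2 eq3.
  have x2E : x2 = x3 * beta by lra.
  have x3_0 : x3 = 0.
    by apply: (mulIf (nz_det beta)); rewrite mul0r -[RHS]eq2 x2E; ring.
  split=> //; last by rewrite x2E x3_0 mul0r.
  by apply: (mulIf nz_alpha); rewrite mul0r -[RHS]eq1; ring.
- apply: (abelian_exists_noncentral table (c := alpha) (k1 := 1) (k2 := 0) (k3 := 0)
    (w1 := 0) (w2 := 1) (w3 := 0) (f1 := 0) (f2 := 0) (f3 := 1));
    try ring; try nonzero.
  by nonzero_eq (-1 : R).
- apply: (abelian_cyclic table (x1 := 1) (x2 := 1) (x3 := 0)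
    (f1 := 1) (f2 := -1) (f3 := alpha - beta)); try ring.
  (* The value at alpha of the characteristic polynomial of the block with eigenvalues beta + i and
     beta - i. *)
  by nonzero_eq (1 + (alpha - beta) * (alpha - beta)).
Qed.

End AbelianItems.

(** * The individual algebras with a Heisenberg ideal *)

Section HeisenbergItems.
Variables (R : realType) (L : lieAlgType R) (E1 E2 E3 E4 : L).
Local Notation V := (vec4 E1 E2 E3 E4).

Lemma table_g47 : is_g47 E1 E2 E3 E4 ->
  lie_basis E1 E2 E3 E4 0 E1 0 (V 2 0 0 0) (V 0 1 0 0) (V 0 1 1 0).
Proof. by move=> h; to_vec4 h. Qed.

Lemma table_g48 (alpha : R) : is_g48 alpha E1 E2 E3 E4 ->
  lie_basis E1 E2 E3 E4 0 E1 0 (V (1 + alpha) 0 0 0) (V 0 1 0 0) (V 0 0 alpha 0).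
Proof. by move=> h; to_vec4 h. Qed.

Lemma table_g49 (alpha : R) : is_g49 alpha E1 E2 E3 E4 ->
  lie_basis E1 E2 E3 E4 0 E1 0
    (V (2 * alpha) 0 0 0) (V 0 alpha (-1) 0) (V 0 1 alpha 0).
Proof. by move=> h; to_vec4 h. Qed.

Lemma cases_g47 (C : R -> Prop) :
    is_g47 E1 E2 E3 E4 -> C 1 ->
  possible_cases2 (L := L) (fun q => contains_1dim_noncentral_ideal q)
    (fun q => exists e1 e2 e3, [/\ adapted_basis q e1 e2 e3,
        e3 = [lie e1, e2], C (struct_const e1 e2 e3 2 3 1)
        & struct_const e1 e2 e3 2 3 2 = 0]).
Proof.
move=> /table_g47 table C1.
apply: (heisenberg_possible_cases (w2 := 0) (w3 := 1) table); first by ring.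
- by nonzero_eq (-1 : R).
- by move=> q; apply: (heisenberg_noncentral table); rewrite pnatr_eq0.
- by have -> : 1 * 1 - 0 * 1 = 1 :> R by ring.
Qed.

(** The matrix is diagonal with entries 1 and alpha, so (1, 1) is not an eigenvector once alpha
    differs from 1; the determinant is alpha. *)
Lemma cases_g48 (alpha : R) (P : {vspace L} -> Prop) (C : R -> Prop) :
    is_g48 alpha E1 E2 E3 E4 -> alpha != 1 ->
    (forall q : {vspace L}, V 1 0 0 0 \in q -> P q) -> C alpha ->
  possible_cases2 P
    (fun q => exists e1 e2 e3, [/\ adapted_basis q e1 e2 e3,
        e3 = [lie e1, e2], C (struct_const e1 e2 e3 2 3 1)
        & struct_const e1 e2 e3 2 3 2 = 0]).
Proof.
move=> /table_g48 table neq1_alpha PE1 Ca.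
apply: (heisenberg_possible_cases (w2 := 1) (w3 := 1) table) => //.
- by nonzero_eq (alpha - 1); rewrite subr_eq0.
- by have -> : 1 * alpha - 0 * 0 = alpha by ring.
Qed.

Lemma cases_g49 (alpha : R) (P : {vspace L} -> Prop) (C : R -> Prop) :
    is_g49 alpha E1 E2 E3 E4 ->
    (forall q : {vspace L}, V 1 0 0 0 \in q -> P q) -> C (alpha * alpha + 1) ->
  possible_cases2 P
    (fun q => exists e1 e2 e3, [/\ adapted_basis q e1 e2 e3,
        e3 = [lie e1, e2], C (struct_const e1 e2 e3 2 3 1)
        & struct_const e1 e2 e3 2 3 2 = 0]).
Proof.
move=> /table_g49 table PE1 Ca.
apply: (heisenberg_possible_cases (w2 := 1) (w3 := 0) table) => //; first by ring.
- by nonzero_eq (-1 : R).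
- by have -> : alpha * alpha - -1 * 1 = alpha * alpha + 1 by ring.
Qed.

End HeisenbergItems.

(** * The individual algebras with a simple ideal *)

Section SimpleItems.
Variables (R : realType) (L : lieAlgType R) (E1 E2 E3 E4 : L).
Local Notation V := (vec4 E1 E2 E3 E4).

Lemma cases_g36_g1 : is_g36_g1 E1 E2 E3 E4 ->
   possible_cases3 (L := L)
     (fun q => (<[E4]> <= q)%VS)
     (fun q => exists e1 e2 e3, [/\ adapted_basis q e1 e2 e3,
        e3 = [lie e1, e2], [lie e2, e3] <> 0 & collinear [lie e2, e3] e2])
     (fun q => exists e1 e2 e3, [/\ adapted_basis q e1 e2 e3,
        e3 = [lie e1, e2], [lie e2, e3] <> 0 & collinear [lie e2, e3] e1]).
Proof.
move=> h; have {h} table : lie_basis E1 E2 E3 E4 (V 0 0 (-1) 0) E1 E2 0 0 0.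
  by to_vec4 h.
have sg2 : -1 * -1 = 1 :> R by ring.
have E4q (q : {vspace L}) : V 0 0 0 1 \in q -> (<[E4]> <= q)%VS.
  by rewrite -memvE -(vec4_E4 E1 E2 E3 E4).
split.
- move=> q gen_q; have dimq := gen_q.1.
  have [a [b [c [d memq]]]] := hyperplane_equation table.1 dimq.
  have [d0 | nz_d] := eqVneq d 0.
    by constructor 1; apply: E4q; rewrite memq d0; apply/eqP; ring.
  have nz_abc := simple_generating_neq0 table dimq memq gen_q.
  have [null | nz_N] := eqVneq (a * a + b * b + -1 * (c * c)) 0.
    constructor 2; apply: (simple_null table dimq memq nz_d nz_abc) => //.
    by apply/eqP; rewrite -subr_eq0 -null; apply/eqP; ring.
  by constructor 3; apply: (simple_nonnull table sg2 dimq memq nz_d nz_abc).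
- by have [q gen_q /E4q] := simple_generating_E4 table; exists q.
- have [q [gen_q dimq memq]] := simple_generating_graph table 1.
  exists q => //; apply: (simple_null table dimq memq) => //; last ring.
    exact: oner_neq0.
  by rewrite oner_eq0.
- have [q [gen_q dimq memq]] := simple_generating_graph table 0.
  exists q => //; apply: (simple_nonnull table sg2 dimq memq).
  + exact: oner_neq0.
  + by rewrite oner_eq0.
  + by nonzero_eq (1 : R).
Qed.

Lemma cases_g37_g1 : is_g37_g1 E1 E2 E3 E4 ->
   possible_cases2 (L := L)
     (fun q => contains_center q)
     (fun q => exists e1 e2 e3, [/\ adapted_basis q e1 e2 e3,
        e3 = [lie e1, e2], [lie e2, e3] <> 0 & collinear [lie e2, e3] e1]).
Proof.
move=> h; have {h} table : lie_basis E1 E2 E3 E4 (V 0 0 1 0) E1 E2 0 0 0.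
  by to_vec4 h.
have sg2 : 1 * 1 = 1 :> R by ring.
split.
- move=> q gen_q; have dimq := gen_q.1.
  have [a [b [c [d memq]]]] := hyperplane_equation table.1 dimq.
  have [d0 | nz_d] := eqVneq d 0.
    by left; apply: (simple_center table sg2); rewrite memq d0; apply/eqP; ring.
  have nz_abc := simple_generating_neq0 table dimq memq gen_q.
  right; apply: (simple_nonnull table sg2 dimq memq nz_d nz_abc).
  (* For [sg = 1] the invariant form is positive definite, so the null case does not arise. *)
  apply: contraTneq nz_abc; rewrite mul1r -!expr2 => /eqP.
  rewrite paddr_eq0 ?addr_ge0 ?sqr_ge0 // paddr_eq0 ?sqr_ge0 // !sqrf_eq0.
  by move=> /andP[/andP[/eqP-> /eqP->] /eqP->]; rewrite eqxx.
- have [q gen_q qE4] := simple_generating_E4 table; exists q => //.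
  exact: (simple_center table sg2).
- have [q [gen_q dimq memq]] := simple_generating_graph table 0.
  exists q => //; apply: (simple_nonnull table sg2 dimq memq).
  + exact: oner_neq0.
  + by rewrite oner_eq0.
  + by nonzero_eq (1 : R).
Qed.

End SimpleItems.

Theorem theorem4 (R : realType) (L : lieAlgType R) (hdim : \dim {:L} = 4%N)
    (E1 E2 E3 E4 : L) :
  (* 1 *)
  (is_2g21 E1 E2 E3 E4 ->
   possible_cases2 (L := L)
     (fun q => contains_1dim_ideal q)
     (fun q => exists e1 e2 e3, [/\ adapted_basis q e1 e2 e3,
        [lie e1, e2] = 0, [lie e2, e3] <> 0 & collinear [lie e2, e3] e3]))
  /\
  (* 2 *)
  ([\/ is_g32_g1 E1 E2 E3 E4,
       exists2 alpha : R, 0 <= alpha /\ alpha <> 1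
         & is_g34_g1 alpha E1 E2 E3 E4
     | is_g43 E1 E2 E3 E4] ->
   possible_cases3 (L := L)
     (fun q => contains_center q)
     (fun q => contains_1dim_noncentral_ideal q)
     (fun q => exists e1 e2 e3, [/\ adapted_basis q e1 e2 e3,
        e3 = [lie e1, e2] & [lie e2, e3] = 0]))
  /\
  (* 3 *)
  ((exists2 alpha : R, 0 <= alpha & is_g35_g1 alpha E1 E2 E3 E4) \/
   is_g41 E1 E2 E3 E4 ->
   possible_cases2 (L := L)
     (fun q => contains_center q)
     (fun q => exists e1 e2 e3, [/\ adapted_basis q e1 e2 e3,
        e3 = [lie e1, e2] & [lie e2, e3] = 0]))
  /\
  (* 4 *)
  (is_g36_g1 E1 E2 E3 E4 ->
   possible_cases3 (L := L)
     (fun q => (<[E4]> <= q)%VS)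
     (fun q => exists e1 e2 e3, [/\ adapted_basis q e1 e2 e3,
        e3 = [lie e1, e2], [lie e2, e3] <> 0 & collinear [lie e2, e3] e2])
     (fun q => exists e1 e2 e3, [/\ adapted_basis q e1 e2 e3,
        e3 = [lie e1, e2], [lie e2, e3] <> 0 & collinear [lie e2, e3] e1]))
  /\
  (* 5 *)
  (is_g37_g1 E1 E2 E3 E4 ->
   possible_cases2 (L := L)
     (fun q => contains_center q)
     (fun q => exists e1 e2 e3, [/\ adapted_basis q e1 e2 e3,
        e3 = [lie e1, e2], [lie e2, e3] <> 0 & collinear [lie e2, e3] e1]))
  /\
  (* 6 *)
  ([\/ exists2 alpha : R, alpha <> 0 /\ alpha <> 1
         & is_g42 alpha E1 E2 E3 E4,
       is_g44 E1 E2 E3 E4,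
       exists alpha beta : R,
         ([/\ -1 < alpha, alpha < beta, beta < 1 & alpha * beta <> 0] \/
          [/\ alpha = -1, 0 < beta & beta < 1]) /\
         is_g45 alpha beta E1 E2 E3 E4
     | exists alpha beta : R, 0 < alpha /\ is_g46 alpha beta E1 E2 E3 E4] ->
   possible_cases2 (L := L)
     (fun q => contains_1dim_noncentral_ideal q)
     (fun q => exists e1 e2 e3, [/\ adapted_basis q e1 e2 e3,
        e3 = [lie e1, e2] & [lie e2, e3] = 0]))
  /\
  (* 7 *)
  ([\/ is_g47 E1 E2 E3 E4,
       exists2 alpha : R, [/\ -1 < alpha, alpha < 1 & alpha <> 0]
         & is_g48 alpha E1 E2 E3 E4
     | exists2 alpha : R, 0 < alpha & is_g49 alpha E1 E2 E3 E4] ->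
   possible_cases2 (L := L)
     (fun q => contains_1dim_noncentral_ideal q)
     (fun q => exists e1 e2 e3, [/\ adapted_basis q e1 e2 e3,
        e3 = [lie e1, e2], struct_const e1 e2 e3 2 3 1 <> 0
        & struct_const e1 e2 e3 2 3 2 = 0]))
  /\
  (* 8 *)
  (is_g48 (-1) E1 E2 E3 E4 \/ is_g49 0 E1 E2 E3 E4 ->
   possible_cases2 (L := L)
     (fun q => contains_center q)
     (fun q => exists e1 e2 e3, [/\ adapted_basis q e1 e2 e3,
        e3 = [lie e1, e2], struct_const e1 e2 e3 2 3 1 <> 0
        & struct_const e1 e2 e3 2 3 2 = 0]))
  /\
  (* 9 *)
  (is_g48 0 E1 E2 E3 E4 ->
   possible_cases2 (L := L)
     (fun q => contains_1dim_noncentral_ideal q)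
     (fun q => exists e1 e2 e3, [/\ adapted_basis q e1 e2 e3,
        e3 = [lie e1, e2], struct_const e1 e2 e3 2 3 1 = 0
        & struct_const e1 e2 e3 2 3 2 = 0])).
Proof.
split; first exact: possible_cases_2g21.
split.
  case=> [|[alpha [ge0 neq1]]|]; first exact: cases_g32_g1.
  - exact: cases_g34_g1.
  - exact: cases_g43.
split.
  by case=> [[alpha _]|]; [exact: cases_g35_g1 | exact: cases_g41].
split; first exact: cases_g36_g1.
split; first exact: cases_g37_g1.
split.
  case=> [[alpha [nz neq1]]||[alpha [beta [ineqs]]]|[alpha [beta [gt0]]]].
  - exact: cases_g42.
  - exact: cases_g44.
  - case: ineqs => [[gtN1 lt_ab lt_b1 /eqP] | [-> gt0 lt1]].
      rewrite mulf_eq0 negb_or => /andP[nz_a nz_b]; apply: cases_g45 => //.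
      + by rewrite lt_eqF.
      + by rewrite lt_eqF // (lt_trans lt_ab).
      + by rewrite lt_eqF.
    apply: cases_g45.
    + by rewrite oppr_eq0 oner_eq0.
    + by rewrite gt_eqF.
    + by rewrite lt_eqF //; lra.
    + by rewrite lt_eqF //; lra.
    + by rewrite lt_eqF.
  - by apply: cases_g46; rewrite gt_eqF.
split.
  case=> [h | [alpha [gtN1 lt1 nz_a]] h | [alpha gt0] h].
  - apply: (cases_g47 (C := fun c => c <> 0) h).
    by apply/eqP; rewrite oner_eq0.
  - apply: (cases_g48 (C := fun c => c <> 0) h) => //; first by rewrite lt_eqF.
    move=> q; apply: (heisenberg_noncentral (table_g48 h)).
    by rewrite gt_eqF //; lra.
  - apply: (cases_g49 (C := fun c => c <> 0) h).
      move=> q; apply: (heisenberg_noncentral (table_g49 h)).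
      by rewrite mulf_neq0 ?pnatr_eq0 ?gt_eqF.
    by apply/eqP; rewrite gt_eqF // ltr_wpDl // -expr2 sqr_ge0.
split.
  (* In both algebras the trace vanishes, so [E1] is central; the determinants are -1 and 1. *)
  case=> h.
  - apply: (cases_g48 (C := fun c => c <> 0) h).
    + by rewrite lt_eqF //; lra.
    + move=> q; apply: (heisenberg_center (w2 := 1) (w3 := 1) (table_g48 h)).
      by nonzero_eq (- 2 : R); rewrite pnatr_eq0.
    + by apply/eqP; rewrite oppr_eq0 oner_eq0.
  - apply: (cases_g49 (C := fun c => c <> 0) h).
    + move=> q; apply: (heisenberg_center (w2 := 1) (w3 := 0) (table_g49 h)).
      by nonzero_eq (-1 : R).
    + by apply/eqP; rewrite mul0r add0r oner_eq0.
(* At alpha = 0 the trace is 1 and the determinant 0: [E1] spans a noncentral ideal and C_23^1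
   vanishes. *)
move=> h; apply: (cases_g48 (C := fun c => c = 0) h) => //.
  by rewrite eq_sym oner_eq0.
move=> q; apply: (heisenberg_noncentral (table_g48 h)).
by rewrite addr0 oner_eq0.
Qed.
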